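(* Let $T>0$ and let $\{X_n, n\ge 1\}$ be a sequence of $E$-valued stochastic processes with trajectories in $D([0,\infty))$ such that $$\forall \varepsilon>0\ \exists \delta>0\ \exists n_0\ \forall n\ge n_0:\quad \mathrm{P}\big(\omega^{T+1}_{X_n}(\delta)\ge\varepsilon\big)\le\varepsilon .$$ Suppose that for every $\alpha\in(0,1)$ there exist, for each $n\ge1$, sequences of random variables $\tau^{(n,\alpha)}=\{\tau^{(n,\alpha)}_k, k\ge0\}$ and $\sigma^{(n,\alpha)}=\{\sigma^{(n,\alpha)}_k, k\ge0\}$ (defined on the same probability space as $X_n$) satisfying $$0\le\tau^{(n,\alpha)}_0\le\sigma^{(n,\alpha)}_0<\tau^{(n,\alpha)}_1<\sigma^{(n,\alpha)}_1<\tau^{(n,\alpha)}_2<\dots,$$ $$\lim_{k\to\infty}\tau^{(n,\alpha)}_k=+\infty,\qquad \lambda\Big(\bigcup_{k\ge0}[\sigma^{(n,\alpha)}_k,\tau^{(n,\alpha)}_{k+1})\Big)=+\infty,$$ and there exists a process $X^{(\alpha)}$ with trajectories in $D([0,T])$, such that: (i) there is $n_0=n_0(T,\alpha)$ with $\mathrm{P}\big(T+1-L_n^{(\alpha)}(T+1)\ge\alpha\big)\le\alpha$ for all $n\ge n_0$; (ii) $X_n^{(\alpha)}\Rightarrow X^{(\alpha)}$ as $n\to\infty$ in $D([0,T])$, where $X^{(\alpha)}_n(t)=X_n(A^{(\alpha)}_n(t))$. Then the distributions of $X_n$ converge weakly in $D([0,T])$ as $n\to\infty$. Moreover, the distributions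 of $X^{(\alpha)}$ converge weakly in $D([0,T])$ as $\alpha\to0+$, and the limit distributions of $\{X^{(\alpha)}\}$ (as $\alpha\to 0+$) and of $\{X_n\}$ (as $n\to\infty$) coincide.
   Context: $(E,\rho)$ is a locally compact metric space. $D([0,\infty))$ and $D([0,T])$ are the spaces of c\`adl\`ag $E$-valued functions on $[0,\infty)$ and $[0,T]$, with the Skorokhod topology; $\Rightarrow$ denotes convergence in distribution. $\lambda$ is Lebesgue measure. The modulus of continuity of a function $f$ is $$\omega^{T}_f(\delta)=\sup_{s,t\in[0,T],\,|s-t|\le\delta}\rho(f(s),f(t)).$$ For given $\tau^{(n,\alpha)},\sigma^{(n,\alpha)}$ put $$L_n^{(\alpha)}(t)=\int_0^t \mathbf 1_{\bigcup_{k\ge0}[\sigma^{(n,\alpha)}_k,\tau^{(n,\alpha)}_{k+1})}(s)\,ds,\qquad A_n^{(\alpha)}(t)=\inf\{s\ge0 : L_n^{(\alpha)}(s)>t\},\quad t\ge0.$$ The process $X_n^{(\alpha)}(t)=X_n(A_n^{(\alpha)}(t))$ is said to be obtained from $X_n$ by deleting the time intervals $\bigcup_k[\tau_k^{(n,\alpha)},\sigma_k^{(n,\alpha)})$.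
   Formalization: E is also assumed complete and separable. Without completeness the claim fails: E=(0,∞), T=1, X_n(t)=|t−1/2|+1/n, deleting [1/2−α/4,1/2+α/4). Separability makes the modulus and the laws on D([0,T]) well defined. *)

(* Defs.v *)
(* MathComp / MathComp-Analysis *)
From HB Require Import structures.
From mathcomp Require Import all_boot all_order all_algebra.
From mathcomp Require Import all_classical all_reals all_analysis.

Set Implicit Arguments.
Unset Strict Implicit.
Unset Printing Implicit Defensive.
Import Order.TTheory GRing.Theory Num.Theory.
Import numFieldNormedType.Exports.

Local Open Scope classical_set_scope.
Local Open Scope ring_scope.

(* [Complete] includes a designated [point]: these spaces are nonempty. *)
#[short(type="completeMetricType")]
HB.structure Definition CompleteMetric (R : numDomainType) :=
  {M of Metric R M & Complete M}.

Definition separable (S : topologicalType) :=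
  exists2 A : set S, countable A & dense A.

Notation borel S := (g_sigma_algebraType (@open S)).

(* At an endpoint of I the filter of the side lying outside I contains set0,
   so that the corresponding condition is vacuous there. *)
Definition cadlag_on (R : realType) (E : topologicalType) (I : set R)
    (f : R -> E) :=
  forall t, I t -> f s @[s --> within I t^'+] --> f t /\
    (exists l : E, f s @[s --> within I t^'-] --> l).

(* D(I): an E-valued function on I is represented by its extension to R that
   takes the value [point] off I, so that Leibniz equality of elements of D(I)
   is equality of functions on I. *)
Record cadlag (R : realType) (E : completeMetricType R) (I : set R) := Cadlag {
  cadlag_fun :> R -> E ;
  cadlag_funP : cadlag_on I cadlag_fun ;
  cadlag_fun_out : forall t, ~ I t -> cadlag_fun t = point }.

Section cadlag_theory.
Context {R : realType} {E : completeMetricType R}.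
Implicit Types (I J : set R) (f : R -> E) (t : R).

Lemma cadlag_on_restrict I f : cadlag_on I f -> cadlag_on I (f \_ I).
Proof.
move=> fI t It; have [fr [l fl]] := fI t It; split.
  rewrite {2}/patch mem_set//; apply: cvg_trans fr; apply: near_eq_cvg.
  by rewrite near_withinE; apply: nearW => s Is; rewrite /patch mem_set.
exists l; apply: cvg_trans fl; apply: near_eq_cvg.
by rewrite near_withinE; apply: nearW => s Is; rewrite /patch mem_set.
Qed.

Lemma restrict_out I f t : ~ I t -> (f \_ I) t = point.
Proof. by move=> It; rewrite /patch memNset. Qed.

Lemma cadlag_on_sub I J f : J `<=` I -> cadlag_on I f -> cadlag_on J f.
Proof.
move=> JI fI t Jt; have [fr [l fl]] := fI t (JI _ Jt).
split; last exists l.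
  apply: cvg_trans fr => U; rewrite !nbhs_simpl /=; rewrite /within/= => HU.
  by apply: filterS HU => s + Js; apply; exact: JI.
apply: cvg_trans fl => U; rewrite !nbhs_simpl /=; rewrite /within/= => HU.
by apply: filterS HU => s + Js; apply; exact: JI.
Qed.

Definition to_cadlag I f (fI : cadlag_on I f) : cadlag E I :=
  Cadlag (cadlag_on_restrict fI) (@restrict_out I f).

End cadlag_theory.

(* Increasing bijections of [0, T] onto itself; they are automatically
   continuous. *)
Definition time_change (R : realType) (T : R) (l : R -> R) :=
  {in `[0, T] &, {homo l : s t / s < t}} /\ l @` `[0, T] = `[0, T]%classic.

(* D([0, T]), to be equipped below with the Skorokhod (J1) topology, whose
   balls are those of the distance
   inf_l max (sup_t |l t - t|) (sup_t rho(x t, y (l t))) over time changes l;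
   the bound r < e avoids the infimum. *)
Definition skorokhod (R : realType) (E : completeMetricType R) (T : R) :=
  cadlag E `[0, T].

Section skorokhod_topology.
Context {R : realType} {E : completeMetricType R} (T : R).
Local Notation D := (skorokhod E T).

HB.instance Definition _ := gen_eqMixin D.
HB.instance Definition _ := gen_choiceMixin D.

Lemma cadlag_on_cst (I : set R) (x : E) : cadlag_on I (cst x).
Proof. by move=> t _; split; [|exists x]; exact: cvg_cst. Qed.

HB.instance Definition _ :=
  isPointed.Build D (to_cadlag (@cadlag_on_cst `[0, T] point)).

Definition skorokhod_ball (x : D) (e : R) (y : D) :=
  exists2 r, r < e & exists2 l, time_change T l &
    forall t, t \in `[0, T] -> `|l t - t| <= r /\ mdist (x t) (y (l t)) <= r.

Let ball := skorokhod_ball.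

Let ball_center x (e : R) : 0 < e -> ball x e x.
Proof.
move=> e0; exists 0 => //; exists id.
  by split=> //; rewrite image_id.
by move=> t _; rewrite subrr normr0 mdistxx.
Qed.

Let ball_sym x y (e : R) : ball x e y -> ball y e x.
Proof.
move=> [r re [l [lh lT] lr]]; exists r => //.
have inv t : exists s, t \in `[0, T] -> s \in `[0, T] /\ l s = t.
  case: (boolP (t \in `[0, T])) => [tT|_]; last by exists 0.
  have : (l @` `[0, T]) t by rewrite lT.
  by move=> [s sT lst]; exists s.
have [m mP] := choice inv.
exists m; [split|].
- move=> s t sT tT st; have [msT ms] := mP s sT; have [mtT mt] := mP t tT.
  rewrite ltNge le_eqVlt; apply/negP => /orP[/eqP mts|mts].
    by move: st; rewrite -ms -mt mts ltxx.
  by have := lh _ _ mtT msT mts; rewrite ms mt ltNge (ltW st).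
- apply/seteqP; split=> [_ [t tT <-]|s sT]; first by have [] := mP t tT.
  have lsT : l s \in `[0, T] by have : (l @` `[0, T]) (l s) by [exists s]; rewrite lT.
  exists (l s) => //; have [mT ml] := mP _ lsT.
  apply/eqP; rewrite eq_le 2!leNgt; apply/andP; split; apply/negP => h.
    by have := lh _ _ sT mT h; rewrite ml ltxx.
  by have := lh _ _ mT sT h; rewrite ml ltxx.
- move=> t tT; have [msT ms] := mP t tT; have [h1 h2] := lr _ msT.
  by rewrite ms in h1 h2; rewrite distrC metric_sym.
Qed.

Let ball_triangle x y z (e1 e2 : R) : ball x e1 y -> ball y e2 z ->
  ball x (e1 + e2) z.
Proof.
move=> [r re [l [lh lT] lr]] [s se [m [mh mT] ms]].
have lin t : t \in `[0, T] -> l t \in `[0, T].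
  by move=> tT; have : (l @` `[0, T]) (l t) by [exists t]; rewrite lT.
exists (r + s); first exact: ltrD.
exists (m \o l); [split|].
- by move=> a b aT bT ab /=; apply: mh; [exact: lin..|exact: lh].
- by rewrite -image_comp lT mT.
- move=> t tT /=; have [h1 h2] := lr t tT; have [h3 h4] := ms _ (lin _ tT).
  split.
    have -> /= : m (l t) - t = (m (l t) - l t) + (l t - t) by rewrite addrA subrK.
    by rewrite (le_trans (ler_normD _ _))// addrC lerD.
  by apply: le_trans (metric_triangle _ (y (l t)) _) _; exact: lerD.
Qed.

Let ent : set_system (D * D) := entourage_ ball.
Let nbhs (x : D) : set_system D := nbhs_ ent x.
Let nbhsE : nbhs = nbhs_ ent. Proof. by []. Qed.
Let entourageE : ent = entourage_ ball. Proof. by []. Qed.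

HB.instance Definition _ := hasNbhs.Build D nbhs.
HB.instance Definition _ := @Nbhs_isPseudoMetric.Build R D
  ent nbhsE ball ball_center ball_sym ball_triangle entourageE.

End skorokhod_topology.

Lemma sub_itv0T_itv0y (R : realType) (T : R) : `[0, T] `<=` (`[0, +oo[ : set R).
Proof. by move=> t; rewrite /= !in_itv/= andbT => /andP[]. Qed.

Definition restrict_path (R : realType) (E : completeMetricType R) (T : R)
    (x : cadlag E `[0, +oo[) : skorokhod E T :=
  to_cadlag (cadlag_on_sub (@sub_itv0T_itv0y R T) (cadlag_funP x)).

Definition modulus (R : realType) (E : completeMetricType R) (T : R)
    (f : R -> E) (delta : R) : \bar R :=
  ereal_sup [set z | exists s t, [/\ s \in `[0, T], t \in `[0, T],
    `|s - t| <= delta & z = (mdist (f s) (f t))%:E]].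

Section deletion.
Context {R : realType}.
Implicit Types (tau sigma : nat -> R) (t : R).

(* The set of times that survive when the intervals [tau k, sigma k[ are
   deleted; the initial interval [0, tau 0[ is discarded as well. *)
Definition kept tau sigma : set R := \bigcup_k `[sigma k, tau k.+1[%classic.

Definition kept_length tau sigma t : R :=
  \int[lebesgue_measure]_(s in `[0, t]) \1_(kept tau sigma) s.

Definition kept_inverse tau sigma t : R :=
  inf [set s | 0 <= s /\ t < kept_length tau sigma s].

Definition deletion_times tau sigma :=
  [/\ 0 <= tau 0 <= sigma 0,
      forall k, sigma k < tau k.+1 < sigma k.+1,
      tau k @[k --> \oo] --> +oo &
      lebesgue_measure (kept tau sigma) = +oo%E].

Lemma kept_length_unbounded tau sigma : deletion_times tau sigma ->
  forall t, exists s, 0 <= s /\ t < kept_length tau sigma s.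
Proof.
move=> [/andP[tau0 sigma0] ts _ Uoo] t.
have mU : measurable (kept tau sigma).
  by apply: bigcup_measurable => k _; exact: measurable_itv.
have sig_ge0 k : 0 <= sigma k.
  elim: k => [|k ih]; first exact: le_trans tau0 sigma0.
  by have /andP[h1 h2] := ts k; rewrite (le_trans ih)// ltW// (lt_trans h1).
pose F n : set R := kept tau sigma `&` `[0, n%:R]%classic.
have mF n : measurable (F n) by apply: measurableI => //; exact: measurable_itv.
have FU : \bigcup_n F n = kept tau sigma.
  apply/seteqP; split=> [s [n _ []]//|s Us]; have [k _ /=] := Us.
  rewrite in_itv/= => /andP[ks _]; exists (Num.truncn s).+1 => //; split=> //=.
  by rewrite in_itv/= (le_trans (sig_ge0 k) ks)/= ltW// truncnS_gt.
have ndF : nondecreasing_seq F.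
  move=> m n mn; apply/subsetPset; apply: setIS => s /=; rewrite !in_itv/=.
  by move=> /andP[-> sm]/=; rewrite (le_trans sm)// ler_nat.
have mFU : measurable (\bigcup_n F n) by rewrite FU.
have : (lebesgue_measure \o F) n @[n --> \oo] --> +oo%E.
  by rewrite -Uoo -FU; exact: nondecreasing_cvg_mu.
move=> /cvgeyPgt/(_ t)[n _ /(_ n (leqnn n))/= tF].
exists n%:R; split=> //; rewrite /kept_length /Rintegral integral_indic//.
have Ffin : lebesgue_measure (F n) \is a fin_num.
  rewrite ge0_fin_numE//; apply: le_lt_trans (ltry n%:R).
  rewrite (@le_trans _ _ (lebesgue_measure (`[0, n%:R] : set R)))//.
    by apply: le_measure => [||s []//]; rewrite inE; [exact: mF|exact: measurable_itv].
  rewrite lebesgue_measure_itv/= lte_fin; case: ifPn => _; last by rewrite lee_fin.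
  by rewrite -EFinD subr0.
by rewrite -lte_fin fineK.
Qed.

Lemma kept_inverse_ge0 tau sigma t : 0 <= kept_inverse tau sigma t.
Proof.
rewrite /kept_inverse.
set S := [set s | _]; have [S0|/set0P/negP/negPn/eqP ->] := pselect (S !=set0).
  by apply: lb_le_inf => // s [].
by rewrite inf0.
Qed.

Lemma kept_inverse_le tau sigma s t : 0 <= s ->
  t < kept_length tau sigma s -> kept_inverse tau sigma t <= s.
Proof. by move=> s0 ts; apply: ge_inf; [exists 0 => u []|]. Qed.

Lemma cadlag_on_kept_inverse (E : completeMetricType R) (x : R -> E)
    tau sigma : deletion_times tau sigma -> cadlag_on `[0, +oo[ x ->
  cadlag_on `[0, +oo[ (x \o kept_inverse tau sigma).
Proof.
move=> del xc.
pose A := kept_inverse tau sigma; rewrite -/A.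
have A0 t : 0 <= A t := kept_inverse_ge0 tau sigma t.
have Sne t : [set s | 0 <= s /\ t < kept_length tau sigma s] !=set0.
  by have [s] := kept_length_unbounded del t; exists s.
have ndA s t : s <= t -> A s <= A t.
  move=> st; apply: lb_le_inf => // u [u0 tu].
  by apply: kept_inverse_le => //; exact: le_lt_trans tu.
move=> t; rewrite /= in_itv/= andbT => t0.
have xcA u : 0 <= u -> x s @[s --> within `[0, +oo[ u^'+] --> x u /\
    (exists l : E, x s @[s --> within `[0, +oo[ u^'-] --> l).
  by move=> u0; apply: xc; rewrite /= in_itv/= u0.
split.
  have [xr _] := xcA _ (A0 t); move=> U /= Ux.
  have [e /= e0 eU] := xr U Ux.
  have [s [s0 ts] sA] : exists2 s, 0 <= s /\ t < kept_length tau sigma s &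
      s < A t + e.
    by apply: inf_adherent => //; split; [exact: Sne|exists 0 => u []].
  exists (kept_length tau sigma s - t) => /=; first by rewrite subr_gt0.
  move=> u /= ud tu u0; have Atu := ndA _ _ (ltW tu).
  have Aus : A u <= s.
    apply: kept_inverse_le => //; move: ud.
    by rewrite distrC gtr0_norm ?subr_gt0// ltrD2r.
  have [->|Aut] := eqVneq (A u) (A t); first exact: nbhs_singleton.
  have Atu' : A t < A u by rewrite lt_neqAle eq_sym Aut.
  apply: eU => //=; last by rewrite in_itv/= A0.
  by rewrite distrC gtr0_norm ?subr_gt0// ltrBlDl (le_lt_trans Aus).
have [t00|tn0] := eqVneq t 0.
  exists point => U _; exists 1 => //= u _ ut.
  by rewrite in_itv/= andbT leNgt -t00 ut.
have tp : 0 < t by rewrite lt_neqAle eq_sym tn0.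
have [[u [u0 ut Au]]|noP] :=
    pselect (exists u, [/\ 0 <= u, u < t & forall s, u < s < t -> A s = A u]).
  exists (x (A u)) => U Ux; exists (t - u) => /=; first by rewrite subr_gt0.
  move=> s /= sd st _; rewrite Au; first exact: nbhs_singleton.
  by move: sd; rewrite st andbT gtr0_norm ?subr_gt0// ltrD2l ltrN2.
have strict u : 0 <= u -> u < t -> exists2 s, u < s < t & A u < A s.
  move=> u0 ut; apply: contrapT => h; apply: noP; exists u; split=> // s ust.
  apply/eqP; rewrite eq_le leNgt ndA ?andbT; last by case/andP: ust => /ltW.
  by apply/negP => us; apply: h; exists s.
pose S := [set A s | s in [set s | 0 <= s < t]].
have S0 : S !=set0 by exists (A 0); exists 0 => //=; rewrite lexx.
have Sub : has_ubound S.
  by exists (A t) => _ [s /andP[_ st] <-]; apply: ndA; exact: ltW.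
have Alt u : 0 <= u -> u < t -> A u < sup S.
  move=> u0 ut; have [s /andP[us st] As] := strict _ u0 ut.
  apply: lt_le_trans As _; apply: ub_le_sup => //; exists s => //=.
  by rewrite st andbT ltW// (le_lt_trans u0).
have b0 : 0 <= sup S by rewrite (le_trans (A0 0))// ltW// Alt.
have [_ [l xl]] := xcA _ b0.
exists l => U /= Ul; have [e /= e0 eU] := xl U Ul.
have [_ [u /andP[u0 ut] <-] Aue] := sup_adherent e0 (conj S0 Sub).
exists (t - u) => /=; first by rewrite subr_gt0.
move=> s /= sd st; rewrite in_itv/= andbT => s0.
have us : u < s by move: sd; rewrite gtr0_norm ?subr_gt0// ltrD2l ltrN2.
apply: eU => /=; last by rewrite in_itv/= A0.
  rewrite gtr0_norm ?subr_gt0 ?Alt// ltrBlDl -ltrBlDr (lt_le_trans Aue)//.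
  by apply: ndA; exact: ltW.
exact: Alt.
Qed.

End deletion.

Definition delete_path (R : realType) (E : completeMetricType R) (T : R)
    (x : cadlag E `[0, +oo[) (tau sigma : nat -> R)
    (del : deletion_times tau sigma) : skorokhod E T :=
  to_cadlag (cadlag_on_sub (@sub_itv0T_itv0y R T)
    (cadlag_on_kept_inverse del (cadlag_funP x))).

Section laws.
Context {R : realType}.

Definition is_process d (Om : measurableType d) (E : completeMetricType R)
    (I : set R) (X : Om -> cadlag E I) :=
  forall t, I t -> measurable_fun setT (fun w => X w t : borel E).

(* The image of P on the Borel sets of S; it is a plain set function, so that
   no proof of measurability of X is needed to write it. For a process with
   paths in [skorokhod E T] and E separable, X is Borel measurable and this is
   its distribution. *)
Definition law d (Om : measurableType d) (S : ptopologicalType)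
    (P : probability Om R) (X : Om -> S) : set (borel S) -> \bar R :=
  pushforward P (X : Om -> borel S).

Definition weak_cvg (S : ptopologicalType) (J : Type) (F : set_system J)
    (mu : J -> set (borel S) -> \bar R) (nu : set (borel S) -> \bar R) :=
  forall h : S -> R, continuous h -> [bounded h x | x in setT] ->
    (\int[mu j]_x (h x)%:E)%E @[j --> F] --> (\int[nu]_x (h x)%:E)%E.

End laws.

(* Main.v *)
Require Import Defs.
From HB Require Import structures.
From mathcomp Require Import all_boot all_order all_algebra.
From mathcomp Require Import all_classical all_reals all_analysis.
From mathcomp Require Import measurable_realfun ring lra.

Set Implicit Arguments.
Unset Strict Implicit.
Unset Printing Implicit Defensive.
Import Order.TTheory GRing.Theory Num.Theory.
Import numFieldNormedType.Exports.

Local Open Scope classical_set_scope.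
Local Open Scope ring_scope.

(* On the event that the modulus of continuity of X_n at scale delta is below
   eps and that the deleted length before T + 1 is below alpha <= delta, the
   inverse time satisfies t <= A_n(t) <= t + alpha on [0, T], so X_n^(alpha)
   stays uniformly within eps of X_n. Hence E g(X_n) and E g(X^(alpha)) have a
   common limit I(g) for every uniformly continuous g with values in [0, 1].
   The laws of the X^(alpha) on the separable space D([0, T]) and the modulus
   of continuity make the sequence X_n asymptotically tight: up to a small
   probability its paths lie in sets from which every sequence has a uniform
   cluster point. Therefore G |-> sup {I(g) : 0 <= g <= 1_G} is countably
   subadditive on open sets, and Caratheodory's construction turns it into a
   Borel probability mu. By construction mu(G) is asymptotically at most
   P(X_n in G) and P(X^(alpha) in G) for G open, and the portmanteau criterion
   gives both weak limits. Borel measurability of D([0, T])-valued processes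
   comes from step approximations on a grid, which converge in the Skorokhod
   topology. *)

(** * Discretized integrals and the portmanteau criterion *)

(** No candidate limit is given, and X_n is compared with X_n^(alpha) only through their distance;
    this is why the test functions are uniformly continuous. The balls on D([0, T]) come from a
    distance that is not complete in general, so finite covers by small balls at every scale do not
    by themselves produce cluster points. The modulus bound supplies what is missing: two paths at
    small Skorokhod distance, one of which oscillates little at that scale, are uniformly close, and
    uniformly Cauchy families converge because E is complete. The cluster points obtained are
    therefore continuous paths. The order of choices matters: delta depends on the accuracy, alpha
    is taken below delta, and the threshold for n depends on alpha. These thresholds are not uniform
    over the scales, so only finitely many scales are controlled at a time, and compactness is used
    by contradiction, along sequences that satisfy more and more constraints. *)

Lemma near_forall_ord (J : Type) (F : set_system J) (FF : Filter F) (n : nat)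
    (B : nat -> set J) :
  (forall i, (i < n)%N -> F (B i)) -> F [set j | forall i, (i < n)%N -> B i j].
Proof.
elim: n => [|n ih] FB; first by apply: filterS filterT.
have h1 := ih (fun i iN => FB i (ltnW iN)).
have h2 := FB n (ltnSn n).
apply: filterS2 h1 h2 => j h1 h2 i; rewrite ltnS leq_eqVlt => /orP[/eqP->//|].
exact: h1.
Qed.

Section unit_valued.
Context d (Om : measurableType d) (R : realType) (P : probability Om R).
Implicit Types (f g : Om -> R).

Lemma integrable_unit f : measurable_fun setT f -> (forall w, 0 <= f w <= 1) ->
  P.-integrable setT (EFin \o f).
Proof.
move=> mf f01; apply: measurable_bounded_integrable => //.
  by rewrite [ltLHS]probability_setT ltry.
exists 1; split => // M M1 w _ /=; have /andP[f0 f1] := f01 w.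
by rewrite ger0_norm// (le_trans f1)// ltW.
Qed.

Lemma integrable_sum_indic (A : nat -> set Om) n : (forall i, measurable (A i)) ->
  P.-integrable setT (EFin \o (fun w => \sum_(i < n) (\1_(A i) w : R))).
Proof.
move=> mA; apply: measurable_bounded_integrable => //.
- by rewrite [ltLHS]probability_setT ltry.
- by apply: measurable_sum => i; exact: measurable_indic.
exists n%:R; split => // M M1 w _ /=; rewrite ger0_norm ?sumr_ge0//.
apply: le_trans (ltW M1); rewrite -[n in leRHS]card_ord -sum1_card natr_sum.
by apply: ler_sum => i _; rewrite indicE lern1 leq_b1.
Qed.

Lemma Rintegral_sum_indic (A : nat -> set Om) n : (forall i, measurable (A i)) ->
  \int[P]_w (\sum_(i < n) (\1_(A i) w : R)) = \sum_(i < n) fine (P (A i)).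
Proof.
move=> mA; elim: n => [|n ih].
  rewrite big_ord0; under eq_Rintegral do rewrite big_ord0.
  by rewrite Rintegral_cst// mul0r.
rewrite big_ord_recr/= -ih; under eq_Rintegral do rewrite big_ord_recr/=.
rewrite RintegralD//; [|exact: integrable_sum_indic|]; last first.
  apply: integrable_unit => [|w]; first exact: measurable_indic.
  by rewrite indicE ler0n lern1 leq_b1.
by congr (_ + _); rewrite /Rintegral integral_indic// setIT.
Qed.

(** Telescope [y] into the increments of [min y i]. The increment over [i, i + 1] lies between the
    indicators of i + 1 < y and of i < y, and the two counts differ by at most the term i = 0. *)
Lemma count_below (n : nat) (y : R) : 0 <= y <= n%:R ->
  y - 1 <= \sum_(i < n) ((i.+1%:R < y)%R%:R : R) <= y.
Proof.
move=> /andP[y0 yn].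
have E m : Num.min y m%:R = \sum_(i < m) (Num.min y i.+1%:R - Num.min y i%:R).
  elim: m => [|m ih]; first by rewrite big_ord0 min_r.
  by rewrite big_ord_recr/= -ih addrC subrK.
have up m : \sum_(i < m) ((i.+1%:R < y)%R%:R : R) <= Num.min y m%:R.
  rewrite E; apply: ler_sum => i _; case: (ltP i.+1%:R y) => h/=.
    by rewrite min_r ?(le_trans _ (ltW h)) ?ler_nat// -natrB// subSnn.
  by rewrite subr_ge0 ge_min lexx.
have lo m : Num.min y m%:R <= \sum_(i < m) ((i%:R < y)%R%:R : R).
  rewrite E; apply: ler_sum => i _; case: (ltP i%:R y) => h/=; last first.
    by rewrite min_l ?subrr// (le_trans h)// ler_nat.
  by rewrite lerBlDr ge_min -[i.+1%:R]natr1 addrC lexx orbT.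
apply/andP; split; last by apply: le_trans (up _) _; rewrite ge_min lexx.
case: n yn E up lo => [|n] yn _ up lo; first by rewrite big_ord0 subr_le0 (le_trans yn).
have := lo n.+1; rewrite (min_l yn) big_ord_recl/= => yl.
rewrite lerBlDl (le_trans yl)// lerD ?lern1 ?leq_b1//.
by rewrite big_ord_recr/= lerDl.
Qed.

(* Discrete layer-cake formula. *)
Lemma Rintegral_layer f n : measurable_fun setT f ->
  (forall w, 0 <= f w <= 1) ->
  let s := \sum_(i < n.+1) fine (P [set w | i.+1%:R < n.+1%:R * f w]) in
  s <= n.+1%:R * \int[P]_w f w <= s + 1.
Proof.
move=> mf f01 /=.
pose A i := [set w | i.+1%:R < n.+1%:R * f w].
have mA i : measurable (A i).
  rewrite -[A i]setTI; rewrite (_ : A i = (fun w => n.+1%:R * f w) @^-1` `]i.+1%:R, +oo[%classic).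
    by apply: measurable_funM => //; exact: measurable_itv.
  by apply/seteqP; split => w /=; rewrite in_itv/= andbT.
have ws w : 0 <= n.+1%:R * f w <= n.+1%:R.
  have /andP[f0 f1] := f01 w; rewrite mulr_ge0//=.
  by rewrite -[leRHS]mulr1 ler_pM2l// ltr0n.
have intf := integrable_unit mf f01.
have intnf : P.-integrable setT (EFin \o (fun w => n.+1%:R * f w)).
  rewrite (_ : _ \o _ = fun w => (n.+1%:R%:E * (EFin \o f) w)%E)//.
  exact: integrableZl.
rewrite -(Rintegral_sum_indic n.+1 mA).
have E w : \sum_(i < n.+1) (\1_(A i) w : R) =
    \sum_(i < n.+1) ((i.+1%:R < n.+1%:R * f w)%R%:R : R).
  apply: eq_bigr => i _; rewrite indicE; congr (_%:R).
  by apply: congr1; rewrite /A; apply/idP/idP => [/set_mem//|h]; exact/mem_set.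
rewrite -RintegralZl//; apply/andP; split.
  apply: le_Rintegral => //; first exact: integrable_sum_indic.
  by move=> w _; rewrite E; case/andP: (count_below (ws w)).
have E1 : \int[P]_w (cst 1 w : R) = 1.
  by rewrite Rintegral_cst// mul1r [X in fine X]probability_setT.
rewrite -[X in _ <= _ + X]E1.
have i1 : P.-integrable setT (EFin \o (cst 1 : Om -> R)).
  by apply: integrable_unit => // w; rewrite /= ler01 lexx.
rewrite -RintegralD//; last exact: integrable_sum_indic.
apply: le_Rintegral => //.
  have := integrableD measurableT (integrable_sum_indic n.+1 mA) i1.
  by apply: eq_integrable.
move=> w _; rewrite E -lerBlDr /=; by case/andP: (count_below (ws w)).
Qed.

End unit_valued.

Lemma continuous_borel (R : realType) (S : ptopologicalType) (h : S -> R) :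
  continuous h -> measurable_fun setT (h : borel S -> R).
Proof.
move=> ch; apply: (measurability _ (RGenOInfty.measurableE R)).
move=> _ [_ [x ->] <-]; rewrite setTI; apply: sub_sigma_algebra.
apply: open_comp; last exact: rray_open.
by move=> y _; exact: ch.
Qed.

Lemma measurable_preimage d (Om : measurableType d) (S : ptopologicalType)
    (Y : Om -> S) (G : set S) :
  measurable_fun setT (Y : Om -> borel S) -> open G -> measurable (Y @^-1` G).
Proof.
move=> mY oG; rewrite -[_ @^-1` _]setTI; apply: mY => //.
exact: sub_sigma_algebra.
Qed.

Section portmanteau.
Context (R : realType) (S : ptopologicalType) (J : Type) (F : set_system J)
  {FF : Filter F} (d : J -> measure_display) (Om : forall j, measurableType (d j))
  (P : forall j, probability (Om j) R) (Y : forall j, Om j -> S)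
  (mu : probability (borel S) R).
Hypothesis mY : \forall j \near F, measurable_fun setT (@Y j : Om j -> borel S).
Hypothesis muG : forall G, open G -> forall e, 0 < e ->
  \forall j \near F, fine (mu G) - e <= fine (P j (@Y j @^-1` G)).

(** The superlevel sets of [h] are open, and the layer-cake sum involves only finitely many of them,
    so the lower bounds on all of them hold eventually at once. *)
Lemma portmanteau_lb (h : S -> R) : continuous h -> (forall x, 0 <= h x <= 1) ->
  forall e, 0 < e ->
  \forall j \near F, \int[mu]_x h x - e <= \int[P j]_w h (@Y j w).
Proof.
move=> ch h01 e e0.
(* With this [n] the discretization error 1 / (n + 1) is at most e / 2; the other half of [e] pays
   for the slack e / 2 allowed on each level set. *)
pose n := Num.truncn (2 / e).
have ne : 1 <= n.+1%:R * (e / 2).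
  have : 2 / e < n.+1%:R by exact: truncnS_gt.
  by move=> /ltW; rewrite ler_pdivrMr// mulrA ler_pdivlMr// mul1r.
pose G i : set S := [set x | i.+1%:R < n.+1%:R * h x].
have oG i : open (G i).
  rewrite (_ : G i = (fun x => n.+1%:R * h x) @^-1` `]i.+1%:R, +oo[%classic).
    apply: open_comp; last exact: rray_open.
    by move=> x _; apply: cvgM; [exact: cvg_cst|exact: ch].
  by apply/seteqP; split => w /=; rewrite in_itv/= andbT.
have near_all : \forall j \near F, forall i, (i < n.+1)%N ->
    fine (mu (G i)) - e / 2 <= fine (P j (@Y j @^-1` G i)).
  by apply: near_forall_ord => i _; apply: muG => //; rewrite divr_gt0.
near=> j.
have /andP[_ h1] := @Rintegral_layer _ _ _ mu h n (continuous_borel ch) h01.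
have mYj : measurable_fun setT (@Y j : Om j -> borel S) by near: j.
have mhY : measurable_fun setT (h \o @Y j).
  exact: (@measurableT_comp _ _ _ _ (borel S) _ _ _ _ (continuous_borel ch) mYj).
have /andP[h2 _] := @Rintegral_layer _ _ _ (P j) (h \o @Y j) n mhY
  (fun w => h01 (@Y j w)).
have Gj : forall i, (i < n.+1)%N ->
    fine (mu (G i)) - e / 2 <= fine (P j (@Y j @^-1` G i)) by near: j.
have : \sum_(i < n.+1) fine (mu (G i)) - n.+1%:R * (e / 2) <=
    \sum_(i < n.+1) fine (P j (@Y j @^-1` G i)).
  rewrite mulr_natl -[n.+1 in X in _ - X]card_ord -sumr_const -sumrB.
  by apply: ler_sum => i _; exact: Gj.
move=> h3; rewrite -(ler_pM2l (_ : 0 < n.+1%:R :> R)) ?ltr0n// mulrBr.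
rewrite [e in X in X <= _](splitr e) mulrDr; move: h1 h2 h3 => /=; lra.
Unshelve. all: by end_near. Qed.

(** The one-sided bound is applied to [h] and to [- h], each rescaled affinely from [-M, M] into
    [0, 1]; together they bound the difference of the integrals on both sides. *)
Lemma weak_cvg_of_open : weak_cvg F (fun j => law (P j) (@Y j)) mu.
Proof.
move=> h ch [M0 [_ hM0]].
pose M := Num.max M0 0 + 1.
have M_gt0 : 0 < M by rewrite ltr_wpDl// le_max lexx orbT.
have hM x : `|h x| <= M.
  by apply: hM0 => //; rewrite /M (le_lt_trans (_ : _ <= Num.max M0 0)) ?le_max ?lexx// ltrDl.
have M20 : 0 < 2 * M by rewrite mulr_gt0.
have H (s : R) : `|s| = 1 -> forall e, 0 < e -> \forall j \near F,
    \int[mu]_x (s * h x) - e <= \int[P j]_w (s * h (@Y j w)).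
  move=> s1 e e0; pose g x := (2 * M)^-1 * (s * h x + M).
  have cg : continuous g.
    move=> x; apply: cvgM; first exact: cvg_cst.
    apply: cvgD; last exact: cvg_cst.
    by apply: cvgM; [exact: cvg_cst|exact: ch].
  have g01 x : 0 <= g x <= 1.
    have := hM x; rewrite -[`|h x|]mul1r -s1 -normrM ler_norml => /andP[a b].
    have v0 : 0 <= s * h x + M by lra.
    apply/andP; split; first by apply: mulr_ge0 => //; rewrite invr_ge0 ltW.
    by rewrite /g ler_pdivrMl// s1; lra.
  have E d0 (O0 : measurableType d0) (p : probability O0 R) (Z : O0 -> S) :
      measurable_fun setT (Z : O0 -> borel S) ->
      \int[p]_w (s * h (Z w)) = 2 * M * \int[p]_w g (Z w) - M.
    move=> mZ.
    have mgZ : measurable_fun setT (g \o Z).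
      exact: (@measurableT_comp _ _ _ _ (borel S) _ _ _ _ (continuous_borel cg) mZ).
    have ig := integrable_unit p mgZ (fun w => g01 (Z w)).
    have i2g : p.-integrable setT (EFin \o (fun w => 2 * M * g (Z w))).
      rewrite (_ : _ \o _ = fun w => ((2 * M)%:E * (EFin \o (g \o Z)) w)%E)//.
      exact: integrableZl.
    have EM : \int[p]_w (cst M w : R) = M.
      by rewrite Rintegral_cst// [X in fine X]probability_setT mulr1.
    rewrite -[X in _ = _ - X]EM -RintegralZl// -RintegralB//; last first.
      exact: finite_measure_integrable_cst.
    by apply: eq_Rintegral => w _; rewrite /g mulVKf ?gt_eqF// addrK.
  have e2M : 0 < e / (2 * M) by rewrite divr_gt0.
  near=> j.
  have mYj : measurable_fun setT (@Y j : Om j -> borel S) by near: j.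
  rewrite (E _ _ _ _ mYj) (E _ _ mu (id : borel S -> S))//.
  have : \int[mu]_x g x - e / (2 * M) <= \int[P j]_w g (@Y j w).
    by near: j; exact: portmanteau_lb.
  rewrite -(ler_pM2l M20) mulrBr (mulrC _ (e / _)) divfK ?gt_eqF//; lra.
have intb d0 (O0 : measurableType d0) (p : probability O0 R) (Z : O0 -> S) :
    measurable_fun setT (Z : O0 -> borel S) ->
    p.-integrable setT (EFin \o (h \o Z)).
  move=> mZ; apply: measurable_bounded_integrable => //.
  - by rewrite [ltLHS]probability_setT ltry.
  - exact: (@measurableT_comp _ _ _ _ (borel S) _ _ _ _ (continuous_borel ch) mZ).
  - exists M; split; first exact: num_real.
    by move=> N MN w _ /=; rewrite (le_trans (hM _))// ltW.
have mulaw : (\int[mu]_x (h x)%:E)%E = (\int[mu]_x h x)%:E.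
  by rewrite /Rintegral fineK//; apply: integrable_fin_num => //; exact: (intb _ _ mu (id : borel S -> S)).
rewrite mulaw.
(* [law] is a plain set function, so the change of variables needs [Y j] measurable, which holds
   only eventually along [F]: for X^(alpha) it is known when 0 < alpha < 1. *)
have near_eq : \forall j \near F,
    (\int[P j]_w h (@Y j w))%:E = (\int[law (P j) (@Y j)]_x (h x)%:E)%E.
  near=> j.
  have mYj : measurable_fun setT (@Y j : Om j -> borel S) by near: j.
  rewrite /law (integral_pushforward mYj) ?preimage_setT//.
  - by rewrite /Rintegral fineK//; apply: integrable_fin_num => //; exact: intb.
  - by apply/measurable_EFinP; exact: continuous_borel.
  - exact: intb.
apply: cvg_trans (near_eq_cvg near_eq) _.
apply: cvg_EFin; first exact: nearW.
apply/cvgrPdist_le => /= e e0.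
near=> j.
have mYj : measurable_fun setT (@Y j : Om j -> borel S) by near: j.
have h1 : \int[mu]_x (1 * h x) - e <= \int[P j]_w (1 * h (@Y j w)).
  by near: j; apply: H => //; rewrite normr1.
have h2 : \int[mu]_x (-1 * h x) - e <= \int[P j]_w (-1 * h (@Y j w)).
  by near: j; apply: H => //; rewrite normrN normr1.
move: h1 h2; rewrite !RintegralZl//; [|exact: intb|exact: (intb _ _ mu (id : borel S -> S))|exact: intb|exact: (intb _ _ mu (id : borel S -> S))].
by rewrite ler_norml => h1 h2; apply/andP; split; lra.
Unshelve. all: by end_near. Qed.

End portmanteau.

(** * Existence of a limit measure *)

Section truncated_distance.
Context (R : realType) (S : pseudoMetricType R).
Implicit Types (F : set S) (x y : S) (g : S -> R).

(* Distance to [F] truncated at 1; it is 1 when [F] is empty. *)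
Definition tdist F x : R :=
  inf ([set 1] `|` [set e | 0 < e /\ exists2 y, F y & ball x e y]).

Let tdist_lb F x :
  has_lbound ([set 1] `|` [set e | 0 < e /\ exists2 y, F y & ball x e y]).
Proof. by exists 0 => e [->|[/ltW]]. Qed.

Lemma tdist01 F x : 0 <= tdist F x <= 1.
Proof.
apply/andP; split; last by apply: ge_inf => //; left.
by apply: lb_le_inf; [exists 1; left|move=> e [->|[/ltW]]].
Qed.

Lemma tdist_le F x y e : 0 < e -> F y -> ball x e y -> tdist F x <= e.
Proof. by move=> e0 Fy xy; apply: ge_inf => //; right; split => //; exists y. Qed.

Lemma tdist_in F x : F x -> tdist F x = 0.
Proof.
move=> Fx; apply/eqP; rewrite eq_le; have /andP[-> _] := tdist01 F x.
rewrite andbT; apply/ler_addgt0Pl => e e0; rewrite addr0.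
by apply: (tdist_le e0 Fx); exact: ballxx.
Qed.

Lemma tdist_lt F x e : e <= 1 -> tdist F x < e -> exists2 y, F y & ball x e y.
Proof.
move=> e1 xe; have ne : ([set 1] `|` [set e | 0 < e /\ exists2 y, F y & ball x e y]) !=set0.
  by exists 1; left.
have [z [->|[z0 [y Fy xy]]] ze] := inf_lt ne xe.
- by move: (le_lt_trans e1 ze); rewrite ltxx.
- by exists y => //; apply: le_ball xy; exact: ltW.
Qed.

Lemma tdist_ball F x y e : 0 < e -> ball x e y -> tdist F x <= tdist F y + e.
Proof.
move=> e0 xy; rewrite -lerBlDr; apply: lb_le_inf; first by exists 1; left.
move=> z [->|[z0 [y' Fy yy]]]; rewrite lerBlDr.
  by have /andP[_ /le_trans] := tdist01 F x; apply; rewrite lerDl ltW.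
apply: (tdist_le _ Fy); first by rewrite addr_gt0.
by rewrite addrC; exact: ball_triangle xy yy.
Qed.

Definition unif01 g := (forall x, 0 <= g x <= 1) /\
  forall eta, 0 < eta -> exists2 e, 0 < e & forall x y, ball x e y ->
    `|g x - g y| <= eta.

Lemma unif01_continuous g : unif01 g -> continuous g.
Proof.
move=> [_ ug] x; apply/cvgrPdist_le => e e0; have [r r0 gr] := ug _ e0.
by near=> y; apply: gr; near: y; exact: near_ball.
Unshelve. all: by end_near. Qed.

Lemma unif01_cst c : 0 <= c <= 1 -> unif01 (cst c).
Proof.
by move=> c01; split=> // eta e0; exists 1 => // x y _; rewrite subrr normr0 ltW.
Qed.

Lemma unif01D f g : unif01 f -> unif01 g -> (forall x, f x + g x <= 1) ->
  unif01 (fun x => f x + g x).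
Proof.
move=> [f01 uf] [g01 ug] fg; split=> [x|eta e0].
  by have /andP[f0 _] := f01 x; have /andP[g0 _] := g01 x; rewrite addr_ge0 ?fg.
have e20 : 0 < eta / 2 by rewrite divr_gt0.
have [r r0 fr] := uf _ e20; have [s s0 gs] := ug _ e20.
exists (Num.min r s); first by rewrite lt_min r0.
move=> x y xy; rewrite opprD addrACA (le_trans (ler_normD _ _))// (splitr eta).
by apply: lerD; [apply: fr|apply: gs]; apply: le_ball xy; rewrite ge_min lexx ?orbT.
Qed.

Lemma unif01_trunc g c : unif01 g -> 0 <= c ->
  unif01 (fun x => Num.max (g x - c) 0).
Proof.
move=> [g01 ug] c0; split=> [x|eta e0].
  have /andP[g0 g1] := g01 x; rewrite le_max lexx orbT ge_max ler01 andbT.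
  by rewrite lerBlDr (le_trans g1)// lerDl.
have [r r0 gr] := ug _ e0; exists r => // x y xy; move: (gr _ _ xy).
by rewrite !ler_norml => /andP[h1 h2]; apply/andP; split;
  case: (leP (g x - c) 0) => ?; case: (leP (g y - c) 0) => ?; lra.
Qed.

(** Approximation from below of the indicator of the complement of [F]. With [F] the complement of
    an open set, it fills that set as [n] grows. *)
Definition ramp n F x := Num.min (n.+1%:R * tdist F x) 1.

Lemma unif01_ramp n F : unif01 (ramp n F).
Proof.
have n0 : 0 < n.+1%:R :> R by rewrite ltr0n.
split=> [x|eta e0].
  have /andP[t0 t1] := tdist01 F x.
  by rewrite le_min mulr_ge0//= ler01 ge_min lexx orbT.
have r0 : 0 < eta / n.+1%:R by rewrite divr_gt0.
exists (eta / n.+1%:R) => // x y xy.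
have h1 := tdist_ball F r0 xy; have h2 := tdist_ball F r0 (ball_sym xy).
have h1' : n.+1%:R * tdist F x <= n.+1%:R * tdist F y + eta.
  by rewrite -[eta](divfK (lt0r_neq0 n0)) [_ / _ * _]mulrC -mulrDr ler_pM2l.
have h2' : n.+1%:R * tdist F y <= n.+1%:R * tdist F x + eta.
  by rewrite -[eta](divfK (lt0r_neq0 n0)) [_ / _ * _]mulrC -mulrDr ler_pM2l.
rewrite /ramp ler_norml; move: h1' h2'; set a := _ * tdist F x; set b := _ * tdist F y.
by move=> h3 h4; apply/andP; split; case: (leP a 1) => ?; case: (leP b 1) => ?; lra.
Qed.

Lemma ramp_in n F x : F x -> ramp n F x = 0.
Proof. by move=> Fx; rewrite /ramp tdist_in// mulr0 min_l. Qed.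

Lemma ramp1 n F x : n.+1%:R^-1 <= tdist F x -> ramp n F x = 1.
Proof.
move=> h; rewrite /ramp min_r//.
by rewrite -ler_pdivrMl ?ltr0n// mulr1.
Qed.

End truncated_distance.

Section limit_measure.
Context (R : realType) (S : pseudoPMetricType R) (d : nat -> measure_display)
  (Om : forall n, measurableType (d n)) (P : forall n, probability (Om n) R)
  (Y : forall n, Om n -> S).
Hypothesis mY : forall n, measurable_fun setT (@Y n : Om n -> borel S).
Let a (g : S -> R) n := \int[P n]_w g (@Y n w).
Hypothesis cvgY : forall g : S -> R, unif01 g -> cvgn (a g).
(** Asymptotic substitute for a compact set of large probability: finitely many constraints [K j] at
    a time, each finite batch only for large [n]. The second clause is the compactness of their
    intersection, phrased for sequences that satisfy ever more constraints. *)
Hypothesis tight : forall eps, 0 < eps -> exists K : nat -> set S,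
  (forall N, \forall n \near \oo, exists B, [/\ measurable B,
     (P n B <= eps%:E)%E &
     forall w, ~ B w -> forall j, (j < N)%N -> K j (@Y n w)]) /\
  (forall u : nat -> S, (forall N j, (j < N)%N -> K j (u N)) ->
     exists x, cluster (u @ \oo) x).

Let I g := limn (a g).

Let integrable_Y g n : unif01 g -> (P n).-integrable setT (EFin \o (fun w => g (@Y n w))).
Proof.
move=> ug; apply: integrable_unit => [|w]; last by case: ug.
exact: (@measurableT_comp _ _ _ _ (borel S) _ _ _ _
  (continuous_borel (unif01_continuous ug)) (@mY n)).
Qed.

Let a01 g n : unif01 g -> 0 <= a g n <= 1.
Proof.
move=> ug; have [g01 _] := ug; apply/andP; split.
  by apply: Rintegral_ge0 => w _; case/andP: (g01 (@Y n w)).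
have -> : 1 = \int[P n]_w (cst 1 w : R).
  by rewrite Rintegral_cst// [X in fine X]probability_setT mulr1.
apply: le_Rintegral => //.
- exact: integrable_Y.
- exact: finite_measure_integrable_cst.
- by move=> w _; case/andP: (g01 (@Y n w)).
Qed.

Let I01 g : unif01 g -> 0 <= I g <= 1.
Proof.
move=> ug; apply/andP; split.
  by apply: limr_ge; [exact: cvgY|apply: nearW => n; case/andP: (a01 n ug)].
by apply: limr_le; [exact: cvgY|apply: nearW => n; case/andP: (a01 n ug)].
Qed.

Let ID f g : unif01 f -> unif01 g -> (forall x, f x + g x <= 1) ->
  I (fun x => f x + g x) = I f + I g.
Proof.
move=> uf ug fg; rewrite /I; apply/cvg_lim => //.
have -> : a (fun x => f x + g x) = fun n => a f n + a g n.
  by apply/funext => n; rewrite /a RintegralD//; exact: integrable_Y.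
by apply: cvgD; exact: cvgY.
Qed.

Let I_trunc g c : unif01 g -> 0 <= c -> I g - c <= I (fun x => Num.max (g x - c) 0).
Proof.
move=> ug c0; have ut := unif01_trunc ug c0; rewrite lerBlDr.
have -> : I (fun x => Num.max (g x - c) 0) + c =
    limn (fun n => a (fun x => Num.max (g x - c) 0) n + c).
  by apply/esym/cvg_lim => //; apply: cvgD; [exact: cvgY|exact: cvg_cst].
apply: ler_lim; first exact: cvgY.
  by apply: is_cvgD; [exact: cvgY|exact: is_cvg_cst].
apply: nearW => n; rewrite -lerBlDr /a.
have cE : \int[P n]_w (cst c w : R) = c.
  by rewrite Rintegral_cst// [X in fine X]probability_setT mulr1.
rewrite -[X in _ - X <= _]cE -RintegralB//; [|exact: integrable_Y|exact: finite_measure_integrable_cst].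
apply: le_Rintegral => //; last by move=> w _; rewrite /= le_max lexx.
- have := integrableB measurableT (integrable_Y n ug)
    (finite_measure_integrable_cst (P n) c measurableT).
  by apply: eq_integrable.
- exact: (integrable_Y n (unif01_trunc ug c0)).
Qed.

Let tests (G : set S) := [set g | unif01 g /\ forall x, ~ G x -> g x = 0].
Let m (G : set S) : R := sup [set I g | g in tests G].

Let tests0 G : tests G (cst 0).
Proof. by split => //; apply: unif01_cst; rewrite lexx ler01. Qed.

Let has_sup_m G : has_sup [set I g | g in tests G].
Proof.
split; first by exists (I (cst 0)), (cst 0).
by exists 1 => _ [g [ug _] <-]; case/andP: (I01 ug).
Qed.

Let m_ge G g : tests G g -> I g <= m G.
Proof. by move=> Gg; apply: ub_le_sup; [case: (has_sup_m G)|exists g]. Qed.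

Let m_le G c : (forall g, tests G g -> I g <= c) -> m G <= c.
Proof.
move=> h; apply: ge_sup; first by case: (has_sup_m G).
by move=> _ [g Gg <-]; exact: h.
Qed.

Let m_ge0 G : 0 <= m G.
Proof. by apply: le_trans (m_ge (tests0 G)); case/andP: (I01 (tests0 G).1). Qed.

Let le_m G H : G `<=` H -> m G <= m H.
Proof.
move=> GH; apply: m_le => g [ug g0]; apply: m_ge; split => // x Hx.
by apply: g0 => /GH.
Qed.

Let m_set0 : m set0 = 0.
Proof.
apply/eqP; rewrite eq_le m_ge0 andbT; apply: m_le => g [ug g0].
have -> : g = cst 0 by apply/funext => x; exact: g0.
rewrite /I (_ : a _ = cst 0) ?lim_cst//; apply/funext => n.
by rewrite /a Rintegral_cst// mul0r.
Qed.

Let m_setT : m setT = 1.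
Proof.
apply/eqP; rewrite eq_le; apply/andP; split.
  by apply: m_le => g [ug _]; case/andP: (I01 ug).
have u1 : unif01 (cst 1 : S -> R) by apply: unif01_cst; rewrite lexx ler01.
have : tests setT (cst 1) by split => // x h; exfalso; exact: h.
move=> /m_ge; apply: le_trans.
rewrite /I (_ : a _ = cst 1) ?lim_cst//; apply/funext => n.
by rewrite /a Rintegral_cst// mul1r [X in fine X]probability_setT.
Qed.

(* Up to an event of small probability, tightness lets finitely many ramps
   supported in the sets [G i] dominate a test function of their union. *)
Let m_bigcup (G : nat -> set S) e : (forall i, open (G i)) -> 0 < e ->
  exists N, m (\bigcup_i G i) <= \sum_(i < N) m (G i) + e.
Proof.
move=> oG e0.
(* One third each for approximating the supremum, for the values of [g] below e / 3, and for the
   exceptional event. *)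
have e30 : 0 < e / 3 by rewrite divr_gt0.
have [_ [g [ug g0] <-] mg] := sup_adherent e30 (has_sup_m (\bigcup_i G i)).
have [K [nearK clusterK]] := tight e30.
(* Otherwise a counterexample for every [N] gives a sequence with a cluster point [x]. By continuity
   [g x] is at least e / 3, so [x] lies in some open [G i] together with a ball, whereas the
   sequence comes arbitrarily close to the complement of [G i]. *)
have [N HN] : exists N, forall x, (forall j, (j < N)%N -> K j x) ->
    e / 3 <= g x -> exists2 i, (i < N)%N & N.+1%:R^-1 <= tdist (~` G i) x.
  apply: contrapT => /forallNP H.
  have /choice[u uP] N : exists x, [/\ forall j, (j < N)%N -> K j x,
      e / 3 <= g x & forall i, (i < N)%N -> tdist (~` G i) x < N.+1%:R^-1].
    have /existsNP[x /not_implyP[x1 /not_implyP[x2 x3]]] := H N.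
    exists x; split => // i iN; rewrite ltNge; apply/negP => h.
    by apply: x3; exists i.
  have [x ux] := clusterK u (fun N => let: And3 h _ _ := uP N in h).
  have gx : e / 3 <= g x.
    rewrite leNgt; apply/negP => gxe.
    have := unif01_continuous ug; move=> /(_ x) /cvgrPdist_lt.
    move=> /(_ (e / 3 - g x)); rewrite subr_gt0 => /(_ gxe) nx.
    have : (u @ \oo) (range u) by exists 0%N => // k _; exists k.
    move=> /ux /(_ nx) [_ [[k _ <-] /=]].
    rewrite ltr_distlC => /andP[_]; rewrite addrC subrK ltNge => /negP; apply.
    by have [] := uP k.
  have [i _ Gix] : (\bigcup_i G i) x.
    by apply: contrapT => /g0 gx0; move: gx; rewrite gx0 leNgt e30.
  have [r /= r0 rG] : nbhs_ball x (G i).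
    by apply/nbhs_ballP; apply: open_nbhs_nbhs; split.
  have r20 : 0 < r / 2 by rewrite divr_gt0.
  have uN : \forall k \near \oo,
      [set u k | k in [set k | (i < k)%N /\ k.+1%:R^-1 < r / 2]] (u k).
    near=> k; exists k => //; split; near: k; first exact: nbhs_infty_gt.
    near=> k; rewrite -[r / 2]invrK ltf_pV2 ?posrE ?invr_gt0 ?ltr0n//.
    rewrite (@le_lt_trans _ _ k%:R) ?ltr_nat//.
    near: k; exact: nbhs_infty_ger.
  have [_ [[k [ik kr] <-] xk]] := ux _ _ uN (nbhsx_ballx x _ r20).
  have [_ _ /(_ i ik) /tdist_lt] := uP k.
  rewrite invf_le1 ?ltr0n// ler1n => /(_ isT)[y Gy uy]; apply: Gy; apply: rG.
  by apply: (ball_split xk); apply: le_ball uy; exact: ltW.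
exists N.
(* A copy of [N]: the slope of the ramps must stay fixed during the later induction on the number of
   terms. *)
have [N1 N1E] : exists N1, N1 = N by exists N.
pose h i := ramp N1 (~` G i).
have uh i : unif01 (h i) by exact: unif01_ramp.
have Ih i : I (h i) <= m (G i).
  by apply: m_ge; split => // x Gx; exact: ramp_in.
suff : I g <= \sum_(i < N) I (h i) + (e / 3 + e / 3).
  move=> Ig; have : \sum_(i < N) I (h i) <= \sum_(i < N) m (G i).
    by apply: ler_sum => i _; exact: Ih.
  by move: mg Ig; rewrite -/(m _); lra.
have cvgs : (fun n => \sum_(i < N) a (h i) n + (e / 3 + e / 3)) @ \oo -->
    \sum_(i < N) I (h i) + (e / 3 + e / 3).
  apply: cvgD; last exact: cvg_cst.
  elim: {HN N1E} N => [|k ih].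
    by rewrite big_ord0; under eq_fun do rewrite big_ord0; exact: cvg_cst.
  rewrite big_ord_recr/=; under eq_fun do rewrite big_ord_recr/=.
  by apply: cvgD => //; exact: cvgY.
rewrite -(cvg_lim _ cvgs)//; apply: ler_lim; [exact: cvgY|exact: cvgP cvgs|].
near=> n.
have [B [mB PB BK]] : exists B, [/\ measurable B, (P n B <= (e / 3)%:E)%E &
     forall w, ~ B w -> forall j, (j < N)%N -> K j (@Y n w)] by near: n.
have pB : fine (P n B) <= e / 3.
  by rewrite -lee_fin fineK// fin_num_measure.
rewrite addrA (le_trans _ (lerD (lexx _) pB))//.
have iB : (P n).-integrable setT (EFin \o (\1_B : Om n -> R)).
  apply: integrable_unit => [|w]; first exact: measurable_indic.
  by rewrite indicE ler0n lern1 leq_b1.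
have ic : (P n).-integrable setT (EFin \o (cst (e / 3) : Om n -> R)).
  exact: finite_measure_integrable_cst.
have isum k : (P n).-integrable setT
    (EFin \o (fun w => \sum_(i < k) h i (@Y n w))).
  elim: k => [|k ih].
    have := finite_measure_integrable_cst (P n) 0 measurableT.
    by apply: eq_integrable => // w _; rewrite /= big_ord0.
  have := integrableD measurableT ih (integrable_Y n (uh k)).
  by apply: eq_integrable => // w _; rewrite /= big_ord_recr.
have asum k : \sum_(i < k) a (h i) n = \int[P n]_w (\sum_(i < k) h i (@Y n w)).
  elim: k => [|k ih].
    rewrite big_ord0; under eq_Rintegral do rewrite big_ord0.
    by rewrite Rintegral_cst// mul0r.
  rewrite big_ord_recr/= ih; under [RHS]eq_Rintegral do rewrite big_ord_recr/=.
  by rewrite RintegralD//; [exact: isum|exact: (integrable_Y n (uh k))].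
have ec : \int[P n]_w (cst (e / 3) w : R) = e / 3.
  by rewrite Rintegral_cst// [X in fine X]probability_setT mulr1.
have eB : fine (P n B) = \int[P n]_w (\1_B w : R).
  by rewrite /Rintegral integral_indic// setIT.
have isc : (P n).-integrable setT
    (EFin \o (fun w => \sum_(i < N) h i (@Y n w) + cst (e / 3) w)).
  by have := integrableD measurableT (isum N) ic; apply: eq_integrable.
rewrite asum -[X in _ + X + _ ]ec eB -RintegralD// -RintegralD//.
apply: le_Rintegral => //; first exact: integrable_Y.
  by have := integrableD measurableT isc iB; apply: eq_integrable.
move=> w _; rewrite /=.
have [g01 _] := ug; have /andP[g_ge0 g_le1] := g01 (@Y n w).
have h0 i : 0 <= h i (@Y n w) by have [/(_ (@Y n w))/andP[]] := uh i.
have s0 : 0 <= \sum_(i < N) h i (@Y n w) by apply: sumr_ge0 => i _.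
have [Bw|Bw] := pselect (B w).
  by rewrite indicE mem_set//=; lra.
rewrite indicE memNset//= addr0.
have [ge|/ltW ge] := leP (e / 3) (g (@Y n w)); last by lra.
have [i iN hi] := HN _ (BK w Bw) ge.
have hi1 : h i (@Y n w) = 1 by apply: ramp1; rewrite N1E.
rewrite (bigD1 (Ordinal iN))//= hi1.
have : 0 <= \sum_(j < N | j != Ordinal iN) h j (@Y n w).
  by apply: sumr_ge0 => j _; exact: h0.
lra.
Unshelve. all: by end_near. Qed.

Let mo (A : set S) : R := inf [set m G | G in [set G | open G /\ A `<=` G]].

Let has_inf_mo A : has_inf [set m G | G in [set G | open G /\ A `<=` G]].
Proof.
split; first by exists (m setT), setT => //; split=> //; exact: openT.
by exists 0 => _ [G _ <-].
Qed.

Let mo_le A G : open G -> A `<=` G -> mo A <= m G.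
Proof. by move=> oG AG; apply: ge_inf; [case: (has_inf_mo A)|exists G]. Qed.

Let mo_ge A c : (forall G, open G -> A `<=` G -> c <= m G) -> c <= mo A.
Proof.
move=> h; apply: lb_le_inf; first by case: (has_inf_mo A).
by move=> _ [G [oG AG] <-]; exact: h.
Qed.

Let mo_open G : open G -> mo G = m G.
Proof.
move=> oG; apply/eqP; rewrite eq_le mo_le//=.
by apply: mo_ge => H _; exact: le_m.
Qed.

Let mo_ge0 A : 0 <= mo A. Proof. by apply: mo_ge. Qed.

Let mu (A : set S) : \bar R := (mo A)%:E.

Let mu_set0 : mu set0 = 0%E.
Proof. by rewrite /mu mo_open ?m_set0//; exact: open0. Qed.

Let mu_ge0 A : (0 <= mu A)%E. Proof. by rewrite lee_fin. Qed.

Let le_mu : {homo mu : A B / A `<=` B >-> (A <= B)%E}.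
Proof.
move=> A B AB; rewrite lee_fin; apply: mo_ge => G oG BG.
by apply: mo_le => //; exact: subset_trans BG.
Qed.

(** Each [F i] is enlarged to an open set at a geometric cost of total e / 2; the other half of [e]
    is spent in [m_bigcup], which leaves a finite partial sum. *)
Let mu_sigma_subadditive : sigma_subadditive mu.
Proof.
move=> F; apply/lee_addgt0Pr => e e0; rewrite (splitr e) EFinD addeA.
have e20 : 0 < e / 2 by rewrite divr_gt0.
have /choice[G GP] i : exists G, [/\ open G, F i `<=` G &
    m G <= mo (F i) + e / 2 / (2 ^ i.+1)%:R].
  have ei : 0 < e / 2 / (2 ^ i.+1)%:R by rewrite divr_gt0// ltr0n expn_gt0.
  have [_ [G [oG FG] <-] Ge] := inf_adherent ei (has_inf_mo (F i)).
  by exists G; split => //; exact: ltW.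
have oG i : open (G i) by case: (GP i).
have [N mG] := m_bigcup oG e20.
apply: (@le_trans _ _ ((\sum_(i < N) m (G i))%:E + (e / 2)%:E)%E).
  rewrite -EFinD lee_fin; apply: le_trans mG.
  apply: mo_le; first exact: bigcup_open.
  by apply: subset_bigcup => i _; case: (GP i).
rewrite leeD2r//; apply: le_trans (epsilon_trick xpredT _ (ltW e20)); last first.
  by move=> i; exact: mu_ge0.
apply: le_trans (nneseries_lim_ge N _); last first.
  move=> i _ _; rewrite -EFinD lee_fin addr_ge0//.
  by rewrite divr_ge0// ltW.
rewrite big_mkord -sumEFin; apply: lee_sum => i _.
by rewrite -EFinD lee_fin; case: (GP i).
Qed.

Let MU : {outer_measure set S -> \bar R} := HB.pack mu
  (isOuterMeasure.Build R S mu mu_set0 mu_ge0 le_mu mu_sigma_subadditive).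

(** For [V] open around [X], a test function [g] of V and G is lowered to g' = (g - e)+. A test
    function [f] of the part of [V] where g < e is never nonzero together with g', so f + g' still
    takes values in [0, 1] and is a test function of [V]. Additivity of [I] then gives the splitting
    up to [e]. *)
Let mu_open_caratheodory G : open G -> MU.-caratheodory G.
Proof.
move=> oG; apply: le_caratheodory_measurable => X.
rewrite -[MU _]/(mu _) -[in leRHS]/(mu _) -[MU (_ `&` ~` _)]/(mu _) -EFinD lee_fin.
apply: mo_ge => V oV XV.
have XVG : mo (X `&` G) <= m (V `&` G).
  by apply: mo_le; [exact: openI|exact: setSI].
apply: le_trans (lerD XVG (lexx _)) _; rewrite -lerBrDr.
apply: m_le => g [ug g0]; rewrite lerBrDr.
apply/ler_addgt0Pl => e e0.
pose g' x := Num.max (g x - e) 0.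
have ug' : unif01 g' by apply: unif01_trunc => //; exact: ltW.
pose V' := V `&` [set x | g x < e].
have oV' : open V'.
  apply: openI => //; rewrite (_ : mkset _ = g @^-1` `]-oo, e[%classic).
    apply: open_comp; last exact: lray_open.
    by move=> y _; exact: unif01_continuous.
  by apply/seteqP; split => x /=; rewrite in_itv.
have XV' : X `&` ~` G `<=` V'.
  move=> x [Xx Gx]; split; first exact: XV.
  by rewrite /= g0// => -[].
have h1 : mo (X `&` ~` G) <= m V' by exact: mo_le.
have h2 : I g - e <= I g' by apply: I_trunc => //; exact: ltW.
suff : m V' <= m V - I g' by move: h1 h2; lra.
apply: m_le => f [uf f0]; rewrite lerBrDr.
have fg x : f x = 0 \/ g' x = 0.
  have [gx|gx] := ltP (g x) e; last by left; apply: f0 => -[_ /=]; rewrite ltNge gx.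
  by right; rewrite /g' max_r// subr_le0 ltW.
have fg1 x : f x + g' x <= 1.
  have [/(_ x)/andP[_ f1] _] := uf; have [/(_ x)/andP[_ g1] _] := ug'.
  by case: (fg x) => ->; rewrite ?add0r ?addr0.
rewrite -ID//; apply: m_ge; split; first exact: unif01D.
move=> x Vx; rewrite f0 ?add0r; last by case.
by rewrite /g' g0 ?max_r// ?sub0r ?oppr_le0 ?ltW//; case.
Qed.

Let borel_caratheodory (A : set (borel S)) : measurable A -> MU.-caratheodory A.
Proof.
move=> mA; apply: (mA MU.-caratheodory); split; last exact: mu_open_caratheodory.
split.
- exact: caratheodory_measurable_set0.
- by move=> B mB; rewrite setTD; exact: caratheodory_measurable_setC.
- exact: caratheodory_measurable_bigcup.
Qed.

Let mu_semi_sigma_additive : semi_sigma_additive (mu : set (borel S) -> _).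
Proof.
move=> A mA tA mU.
exact: (@caratheodory_measure_sigma_additive R S MU A
  (fun i => borel_caratheodory (mA i)) tA (borel_caratheodory mU)).
Qed.

HB.instance Definition _ := isMeasure.Build _ _ _ (mu : set (borel S) -> \bar R)
  mu_set0 mu_ge0 mu_semi_sigma_additive.

Let mu_setT : (mu : set (borel S) -> \bar R) setT = 1%E.
Proof. by rewrite /mu mo_open ?m_setT//; exact: openT. Qed.

HB.instance Definition _ := Measure_isProbability.Build _ _ _
  (mu : set (borel S) -> \bar R) mu_setT.

(** Stated with a test function as witness: any other family whose integrals of [g] have the same
    limits inherits the lower bound on [G]. *)
Lemma limit_measure : exists mu : probability (borel S) R,
  forall G, open G -> forall e, 0 < e -> exists2 g, unif01 g /\
    (forall x, ~ G x -> g x = 0) &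
    fine (mu G) - e <= limn (fun n => \int[P n]_w g (@Y n w)).
Proof.
exists (mu : probability (borel S) R) => G oG e e0.
have [_ [g Gg <-] h] := sup_adherent e0 (has_sup_m G).
exists g => //; apply: ltW; apply: le_lt_trans h.
by rewrite lerD2r -[fine _]/(mo G) mo_open.
Qed.

End limit_measure.

(** * Grid approximations in the Skorokhod topology *)

Lemma nat_ceil (R : realType) (y : R) : 0 <= y ->
  exists K : nat, y <= K%:R < y + 1.
Proof.
move=> y0; have /andP[h1 h2] := truncn_itv y0.
have [e|ne] := eqVneq y (Num.truncn y)%:R.
  by exists (Num.truncn y); rewrite -e lexx ltrDl ltr01.
exists (Num.truncn y).+1; rewrite ltW//= -natr1 ltrD2r lt_neqAle h1 andbT.
by rewrite eq_sym.
Qed.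

Lemma truncn_near_right (R : realType) (t h : R) : 0 < h -> 0 <= t ->
  \forall s \near t^'+, Num.truncn (s / h) = Num.truncn (t / h).
Proof.
move=> h0 t0; have th0 : 0 <= t / h by rewrite divr_ge0// ltW.
have /andP[h1 h2] := truncn_itv th0.
have lt : t < (Num.truncn (t / h)).+1%:R * h by rewrite -ltr_pdivrMr.
near=> s; have ts : t < s by [].
apply: truncn_def; rewrite (le_trans h1)/=; last by rewrite ler_pM2r ?invr_gt0// ltW.
by rewrite ltr_pdivrMr//; near: s; exact: nbhs_right_lt.
Unshelve. all: by end_near. Qed.

(** The index is the ceiling of t / h minus one, which differs from the index at [t] exactly when
    [t] is a grid point. *)
Lemma truncn_near_left (R : realType) (t h : R) : 0 < h -> 0 < t ->
  exists k, \forall s \near t^'-, Num.truncn (s / h) = k.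
Proof.
move=> h0 t0; have th0 : 0 <= t / h by rewrite divr_ge0// ltW.
have [[|k] /andP[h1 h2]] := nat_ceil th0.
  by move: h1; rewrite leNgt divr_gt0.
exists k; move: h2; rewrite -natr1 ltrD2r => h2.
have lt : k%:R * h < t by rewrite -ltr_pdivlMr.
near=> s; have st : s < t by [].
apply: truncn_def; apply/andP; split.
  by rewrite ler_pdivlMr// ltW//; near: s; exact: nbhs_left_gt.
by apply: lt_le_trans h1; rewrite ltr_pM2r ?invr_gt0.
Unshelve. all: by end_near. Qed.

Section step_paths.
Context (R : realType) (E : completeMetricType R) (T : R).
Hypothesis T0 : 0 < T.
Implicit Types (N : nat) (v : nat -> E).

Definition mesh N : R := T / N.+1%:R.

Lemma mesh_gt0 N : 0 < mesh N. Proof. by rewrite divr_gt0// ltr0n. Qed.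

Lemma mesh_lt e : 0 < e -> exists N0, forall N, (N0 <= N)%N -> mesh N < e.
Proof.
move=> e0; exists (Num.truncn (T / e)) => N NN.
rewrite ltr_pdivrMr ?ltr0n// mulrC -ltr_pdivrMr//.
by rewrite (lt_le_trans (truncnS_gt _))// ler_nat.
Qed.

Lemma cadlag_on_step N v :
  cadlag_on `[0, T] (fun t => v (Num.truncn (t / mesh N))).
Proof.
move=> t /=; rewrite in_itv/= => /andP[t0 tT].
split.
  apply: cvg_near_cst; rewrite near_withinE.
  have := truncn_near_right (mesh_gt0 N) t0.
  by apply: filterS => s ->.
have [->|tn0] := eqVneq t 0.
  exists point => U _; exists 1 => //= u _ ut.
  by rewrite in_itv/= leNgt ut.
have tp : 0 < t by rewrite lt_neqAle eq_sym tn0.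
have [k nk] := truncn_near_left (mesh_gt0 N) tp.
exists (v k); apply: cvg_near_cst; rewrite near_withinE.
by move: nk; apply: filterS => s ->.
Qed.

Definition step_path N v : skorokhod E T := to_cadlag (@cadlag_on_step N v).

(* [K] is the index of the first grid point to the right of [t]; [l] is a
   time change from [0, t] to [0, K h]. *)
Let matched (x : R -> E) e t := exists N0, forall N, (N0 <= N)%N ->
  exists (K : nat) (l : R -> R), [/\
    t <= K%:R * mesh N < t + mesh N /\ l 0 = 0 /\ l t = K%:R * mesh N,
    forall r s, 0 <= r -> r < s -> s <= t -> l r < l s,
    forall u, 0 <= u <= K%:R * mesh N -> exists2 s, 0 <= s <= t & l s = u,
    forall s, 0 <= s <= t -> `|l s - s| <= mesh N &
    forall s, 0 <= s < t ->
      mdist (x s) (x ((Num.truncn (l s / mesh N))%:R * mesh N)) <= e].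

Let matched0 x e : matched x e 0.
Proof.
exists 0%N => N _; exists 0%N, id; rewrite mul0r add0r mesh_gt0 lexx; split => //.
- by move=> u u0; exists u.
- by move=> s _; rewrite subrr normr0 ltW// mesh_gt0.
- by move=> s /andP[s0 s1]; move: (le_lt_trans s0 s1); rewrite ltxx.
Qed.

(** [l] is continued affinely from [s, t] onto [K h, K' h], with K' the ceiling of t / h; a mesh
    below t - s forces K < K'. The cells strictly before K' start at grid points in [s, t), because
    K h >= s and (K' - 1) h < t, so the oscillation bound applies to them. *)
Let matched_extend x e s t : 0 <= s -> s < t -> matched x e s ->
  (forall a b, s <= a < t -> s <= b < t -> mdist (x a) (x b) <= e) ->
  matched x e t.
Proof.
move=> s0 st [N0 HN0] osc.
have ts0 : 0 < t - s by rewrite subr_gt0.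
have [N1 HN1] := mesh_lt ts0.
exists (maxn N0 N1) => N; rewrite geq_max => /andP[/HN0 + /HN1].
have := mesh_gt0 N; set h := mesh N => h0.
move=> [K [l [[/andP[sK Ks] [l0 ls]] lmono lsurj lid lx]]] hts.
have th0 : 0 <= t / h by rewrite divr_ge0 ?ltW// (le_lt_trans s0).
have [K' /andP[tK' K't]] := nat_ceil th0.
have tK'h : t <= K'%:R * h by rewrite -ler_pdivrMr.
have K'th : K'%:R * h < t + h.
  by rewrite -ltr_pdivlMr// mulrDl divff ?gt_eqF.
have KK' : K%:R * h < K'%:R * h by lra.
pose q := (K'%:R * h - K%:R * h) / (t - s).
have q0 : 0 < q by rewrite divr_gt0// subr_gt0.
have qts : q * (t - s) = K'%:R * h - K%:R * h by rewrite divfK// gt_eqF.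
pose l' u := if u <= s then l u else K%:R * h + q * (u - s).
have l'l u : u <= s -> l' u = l u by rewrite /l' => ->.
have l's u : s <= u -> l' u = K%:R * h + q * (u - s).
  rewrite le_eqVlt => /orP[/eqP<-|su]; last by rewrite /l' leNgt su.
  by rewrite /l' lexx ls subrr mulr0 addr0.
exists K', l'; split.
- split; first by rewrite tK'h K'th.
  split; first by rewrite l'l.
  by rewrite l's ?ltW// qts; ring.
- move=> r r' r0 rr' r't.
  have [r's|sr'] := leP r' s.
    by rewrite !l'l//; [exact: lmono|exact: le_trans (ltW rr') _].
  rewrite (l's r') ?(ltW sr')//; have [rs|sr] := ltP r s.
    rewrite l'l ?ltW//; have lr := lmono _ _ r0 rs (lexx s).
    rewrite (lt_trans lr)// ls ltrDl mulr_gt0// subr_gt0//.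
  by rewrite l's// ltrD2l ltr_pM2l// ltrD2r.
- move=> u /andP[u0 uK']; have [uK|Ku] := leP u (K%:R * h).
    have [|r /andP[r0 rs] <-] := lsurj u; first by rewrite u0.
    by exists r; rewrite ?l'l// r0 (le_trans rs)// ltW.
  exists (s + (u - K%:R * h) / q).
    have : 0 <= (u - K%:R * h) / q by rewrite divr_ge0// ?ltW// subr_gt0.
    move=> h1; rewrite addr_ge0//= -lerBrDl ler_pdivrMr// [_ * q]mulrC qts.
    by rewrite lerD2r.
  rewrite l's; last by rewrite lerDl divr_ge0// ?ltW// subr_gt0.
  by rewrite [s + _]addrC addrK [q * _]mulrC divfK ?gt_eqF// addrC subrK.
- move=> r /andP[r0 rt]; have [rs|/ltW sr] := leP r s.
    by rewrite l'l//; apply: lid; rewrite r0.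
  (* Linear interpolation of the displacements at the two ends. *)
  rewrite l's//; pose w := (r - s) / (t - s).
  have w0 : 0 <= w by rewrite divr_ge0 ?subr_ge0// ltW.
  have w1 : w <= 1 by rewrite ler_pdivrMr// mul1r lerD2r.
  have E1 : r - s = w * (t - s) by rewrite divfK ?gt_eqF.
  have E2 : q * (r - s) = w * (K'%:R * h - K%:R * h) by rewrite E1 mulrCA qts.
  have -> : K%:R * h + q * (r - s) - r =
      (1 - w) * (K%:R * h - s) + w * (K'%:R * h - t).
    by rewrite E2 -[X in _ - X = _](subrK s r) E1; ring.
  rewrite ger0_norm.
    rewrite (_ : h = (1 - w) * h + w * h); last by ring.
    by rewrite lerD// ler_wpM2l ?subr_ge0//; lra.
  by rewrite addr_ge0// mulr_ge0 ?subr_ge0.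
- move=> r /andP[r0 rt]; have [rs|sr] := ltP r s.
    by rewrite (l'l _ (ltW rs)); apply: lx; rewrite r0.
  have l'r0 : K%:R * h <= l' r by rewrite l's// lerDl mulr_ge0 ?subr_ge0// ltW.
  have l'rK : l' r < K'%:R * h.
    have -> : K'%:R * h = K%:R * h + q * (t - s) by rewrite qts addrC subrK.
    by rewrite l's// ltrD2l ltr_pM2l// ltrD2r.
  have l'r1 : 0 <= l' r by apply: le_trans l'r0; exact: le_trans sK.
  have lh0 : 0 <= l' r / h by apply: divr_ge0 => //; exact: ltW.
  have /andP[k1 k2] := truncn_itv lh0.
  apply: osc; first by rewrite sr.
  have k3 : (K <= Num.truncn (l' r / h))%N.
    by rewrite -ltnS -(ltr_nat R) (le_lt_trans _ k2)// ler_pdivlMr.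
  rewrite (le_trans sK) ?ler_pM2r ?ler_nat//=.
  have k4 : (Num.truncn (l' r / h) < K')%N.
    by rewrite -(ltr_nat R) (le_lt_trans k1)// ltr_pdivrMr.
  rewrite -ltr_pdivlMr// -(ltrD2r 1) natr1 (le_lt_trans _ K't)// ler_nat//.
Qed.

Let matchedT (x : R -> E) e : cadlag_on `[0, T] x -> 0 < e -> matched x e T.
Proof.
(* Real induction on the end point, by the left limits and right continuity. *)
move=> xc e0; have e20 : 0 < e / 2 by rewrite divr_gt0.
pose S := [set t | 0 <= t <= T /\ matched x e t].
have S0 : S 0 by split; [rewrite lexx ltW|exact: matched0].
have Sub : has_ubound S by exists T => t [/andP[]].
have supS : has_sup S by split => //; exists 0.
have b0 : 0 <= sup S by apply: ub_le_sup.
have bT : sup S <= T by apply: ge_sup; [exists 0|move=> t [/andP[]]].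
have bI : `[0, T]%classic (sup S) by rewrite /= in_itv/= b0.
have [xr [l xl]] := xc _ bI.
have Sb : matched x e (sup S).
  have [r /= r0 rl] := xl _ (nbhsx_ballx l _ e20).
  have [s [/andP[s0 sT] Ss] sr] := sup_adherent r0 supS.
  have sb : s <= sup S by apply: ub_le_sup => //; split => //; rewrite s0.
  move: sb; rewrite le_eqVlt => /orP[/eqP <-//|sb].
  apply: (matched_extend s0 sb Ss).
  have close u : s <= u < sup S -> mdist l (x u) <= e / 2.
    move=> /andP[su ub]; have : ball l (e / 2) (x u).
      apply: rl => //=; last first.
        by rewrite in_itv/= (le_trans s0 su)/= (le_trans (ltW ub)).
      by rewrite gtr0_norm ?subr_gt0// ltrBlDl -ltrBlDr (lt_le_trans sr).
    by rewrite ballEmdist/= => /ltW.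
  move=> a b sa sb'; rewrite (le_trans (metric_triangle _ l _))// (splitr e).
  by rewrite lerD ?close// metric_sym close.
have [<-//|bnT] := eqVneq (sup S) T.
have {bnT}bT' : sup S < T by rewrite lt_neqAle bnT.
have [r /= r0 rl] := xr _ (nbhsx_ballx (x (sup S)) _ e20).
pose t := Num.min (sup S + r) T.
have bt : sup S < t by rewrite lt_min ltrDl r0.
suff : t <= sup S by rewrite leNgt bt.
apply: ub_le_sup => //; split.
  by rewrite (le_trans b0 (ltW bt)) ge_min lexx orbT.
apply: (matched_extend b0 bt Sb).
have close u : sup S <= u < t -> mdist (x (sup S)) (x u) <= e / 2.
  move=> /andP[]; rewrite le_eqVlt => /orP[/eqP<- _|su ut].
    by rewrite mdistxx ltW.
  move: ut; rewrite lt_min => /andP[ur uT].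
  have : ball (x (sup S)) (e / 2) (x u).
    apply: rl => //=; last first.
      by rewrite in_itv/= (le_trans b0 (ltW su)) ltW.
    by rewrite distrC gtr0_norm ?subr_gt0// ltrBlDl.
  by rewrite ballEmdist/= => /ltW.
move=> a b sa sb'; rewrite (le_trans (metric_triangle _ (x (sup S)) _))// (splitr e).
by rewrite lerD ?close// metric_sym close.
Qed.

(** Sampling at grid points misplaces a jump by at most one mesh, which the time change absorbs. The
    error e / 4 + e / 4 in space comes from the oscillation of [x] and from the perturbation [v] of
    its samples. *)
Lemma step_path_ball (x : skorokhod E T) e : 0 < e ->
  exists N0, forall N, (N0 <= N)%N -> forall v,
    (forall i, (i <= N.+1)%N -> mdist (x (i%:R * mesh N)) (v i) <= e / 4) ->
    ball x e (step_path N v).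
Proof.
move=> e0; have e40 : 0 < e / 4 by rewrite divr_gt0.
have [N0 HN0] := matchedT (cadlag_funP x) e40; have [N1 HN1] := mesh_lt e40.
exists (maxn N0 N1) => N; rewrite geq_max => /andP[/HN0 + /HN1 he] v vx.
have := mesh_gt0 N; set h := mesh N => h0.
move=> [K [l [[/andP[TK KT] [l0 lT]] lmono lsurj lid lx]]].
have TN : T = N.+1%:R * h by rewrite mulrC divfK// pnatr_eq0.
(* T is itself a grid point, so [l] ends exactly at T and is a time change of [0, T]. *)
have KN : K = N.+1.
  apply/eqP; rewrite eqn_leq -ltnS; apply/andP; split.
    by rewrite -(ltr_nat R) -(ltr_pM2r h0) -natr1 mulrDl mul1r -TN.
  by rewrite -(ler_nat R) -(ler_pM2r h0) -TN.
rewrite KN -TN in lT lsurj.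
exists (e / 4 + e / 4); first lra.
exists l.
  split.
    move=> r s; rewrite !in_itv/= => /andP[r0 _] /andP[_ sT] rs.
    exact: lmono.
  apply/seteqP; split=> [_ [t /= + <-]|u /=]; last first.
    rewrite in_itv/= => uT; have [s sT <-] := lsurj u uT.
    by exists s => //=; rewrite in_itv.
  rewrite !in_itv/= => /andP[t0 tT]; apply/andP; split.
    move: t0; rewrite le_eqVlt => /orP[/eqP<-|t0]; first by rewrite l0.
    by rewrite -l0 ltW// lmono.
  move: tT; rewrite le_eqVlt => /orP[/eqP->|tT]; first by rewrite lT.
  by rewrite -lT ltW// lmono.
move=> t tT'; have := tT'; rewrite in_itv/= => /andP[t0 tT]; split.
  apply: le_trans (lid _ _) _; first by rewrite t0.
  by move: he e40; rewrite -/h; lra.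
have lT01 : 0 <= l t <= T.
  apply/andP; split.
    move: t0; rewrite le_eqVlt => /orP[/eqP<-|t0']; first by rewrite l0.
    by rewrite -l0 ltW// lmono.
  move: tT; rewrite le_eqVlt => /orP[/eqP->|tT1]; first by rewrite lT.
  by rewrite -lT ltW// lmono.
rewrite [X in mdist _ X](_ : _ = v (Num.truncn (l t / h))); last first.
  by rewrite /= /patch mem_set//= in_itv.
have /andP[lt0 ltT] := lT01.
have kN : (Num.truncn (l t / h) <= N.+1)%N.
  rewrite -(ler_nat R); apply: (@le_trans _ _ (l t / h)).
    by rewrite truncn_le divr_ge0// ltW.
  by rewrite ler_pdivrMr// -TN.
apply: le_trans (metric_triangle _ (x ((Num.truncn (l t / h))%:R * h)) _) _.
apply: lerD; last exact: vx.
(* [matched] says nothing about the values at its end point; at T the sampled time is T itself. *)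
move: tT; rewrite le_eqVlt => /orP[/eqP tT1|tT1]; last by apply: lx; rewrite t0.
rewrite tT1 lT (_ : T / h = N.+1%:R); last by rewrite [X in X / _]TN mulfK ?gt_eqF.
by rewrite natrK -TN mdistxx ltW.
Qed.

End step_paths.

(** * Measurability *)

Lemma measurable_comprehension_le d (Om : measurableType d) (R : realType)
    (f g : Om -> R) : measurable_fun setT f -> measurable_fun setT g ->
  measurable [set w | f w <= g w].
Proof.
by move=> mf mg; rewrite -[mkset _]setTI; exact: measurable_fun_le.
Qed.

Lemma measurable_comprehension_lt d (Om : measurableType d) (R : realType)
    (f g : Om -> R) : measurable_fun setT f -> measurable_fun setT g ->
  measurable [set w | f w < g w].
Proof.
move=> mf mg; rewrite (_ : mkset _ = ~` [set w | g w <= f w]).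
  by apply: measurableC; exact: measurable_comprehension_le.
by apply/seteqP; split => w /=; rewrite ltNge => /negP.
Qed.

Lemma measurable_fun_countable_case d d' (Om : measurableType d)
    (S : measurableType d') (I : countType) (k : Om -> I) (f : I -> Om -> S) :
  (forall i, measurable [set w | k w = i]) ->
  (forall i, measurable_fun setT (f i)) ->
  measurable_fun setT (fun w => f (k w) w).
Proof.
move=> mk mf _ B mB; rewrite setTI.
rewrite (_ : _ @^-1` B = \bigcup_i ([set w | k w = i] `&` f i @^-1` B)).
  apply: countable_bigcupT_measurable; first exact: countableP.
  move=> i; apply: measurableI => //.
  by rewrite -[_ @^-1` _]setTI; exact: mf.
apply/seteqP; split=> [w /= Bw|w /= [i _ [<-]]//].
by exists (k w).
Qed.

Section borel_maps.
Context (R : realType) (S : pseudoPMetricType R).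

Lemma tdist_continuous (F : set S) : continuous (tdist F).
Proof.
move=> x; apply/cvgrPdist_le => e e0.
near=> y; have xy : ball x e y by near: y; exact: near_ball.
have h1 := tdist_ball F e0 xy; have h2 := tdist_ball F e0 (ball_sym xy).
by rewrite ler_norml; apply/andP; split; lra.
Unshelve. all: by end_near. Qed.

Lemma tdist_open (G : set S) : open G -> G = [set x | 0 < tdist (~` G) x].
Proof.
move=> oG; apply/seteqP; split=> x /=.
  move=> Gx; have /nbhs_ballP[r /= r0 rG] : nbhs x G by apply: open_nbhs_nbhs; split.
  have m0 : 0 < Num.min r 1 by rewrite lt_min r0 ltr01.
  apply: (lt_le_trans m0); rewrite leNgt; apply/negP => /tdist_lt[].
    by rewrite ge_min lexx orbT.
  by move=> y Gy xy; apply/Gy/rG; apply: le_ball xy; rewrite ge_min lexx.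
by move=> h; apply: contrapT => Gx; move: h; rewrite tdist_in// ltxx.
Qed.

Lemma measurable_borel d (Om : measurableType d) (Y : Om -> S) :
  (forall G : set S, open G -> measurable (Y @^-1` G)) ->
  measurable_fun setT (Y : Om -> borel S).
Proof.
move=> mY; apply: (@measurability _ _ _ (borel S) setT Y (@open S) erefl).
by move=> _ [G oG <-]; rewrite setTI; exact: mY.
Qed.

(** An open set is where the distance to its complement is positive, which reduces the claim to
    limits of real-valued functions. *)
Lemma measurable_borel_cvg d (Om : measurableType d) (Z : nat -> Om -> S)
    (Y : Om -> S) :
  (forall n, measurable_fun setT (Z n : Om -> borel S)) ->
  (forall w, Z n w @[n --> \oo] --> Y w) ->
  measurable_fun setT (Y : Om -> borel S).
Proof.
move=> mZ ZY; apply: measurable_borel => G oG.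
rewrite (tdist_open oG).
have mt : measurable_fun setT (fun w => tdist (~` G) (Y w)).
  apply: (@measurable_fun_cvg _ _ _ _ (fun n w => tdist (~` G) (Z n w))).
    move=> n; apply: (@measurableT_comp _ _ _ _ (borel S) _ _ _ _ _ (mZ n)).
    by apply: continuous_borel; exact: tdist_continuous.
  move=> w _; apply: continuous_cvg; [exact: tdist_continuous|exact: ZY].
have := measurable_comprehension_lt (@measurable_cst _ _ Om _ setT (0 : R)) mt.
by [].
Qed.

End borel_maps.

(** * Quantization along a dense sequence, and Borel measurability of processes *)

Section separable_metric.
Context (R : realType) (E : completeMetricType R) (E_separable : separable E).

Lemma dense_seq : exists e : nat -> E, forall y r, 0 < r ->
  exists i, mdist y (e i) < r.
Proof.
have [A cA dA] := E_separable.
have dAy y r : 0 < r -> exists2 z, A z & mdist y z < r.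
  move=> r0; have y_in : (ball y r)° !=set0.
    by exists y; apply: nbhs_singleton; apply: nbhs_interior; exact: nbhsx_ballx.
  have [z [yz Az]] := dA _ y_in (@open_interior _ (ball y r)).
  by exists z => //; have := interior_subset yz; rewrite ballEmdist.
have /pfcard_geP[A0|[f]] : (A #<= [set: nat])%card by [].
  by have [z] := dAy point 1 ltr01; rewrite A0.
exists f => y r r0; have [z Az yz] := dAy y r r0.
have [i _ fi] := 'surj_f Az.
by exists i; rewrite fi.
Qed.

Lemma open_mdist_lt (c : E) r : open [set y : E | mdist y c < r].
Proof.
rewrite openE => y /= yc; apply/nbhs_ballP; exists (r - mdist y c) => /=.
  by rewrite subr_gt0.
move=> z; rewrite ballEmdist/= => yz.
rewrite (le_lt_trans (metric_triangle _ y _))// metric_sym.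
by rewrite -ltrBrDr.
Qed.

Context (e : nat -> E).
Hypothesis eP : forall y r, 0 < r -> exists i, mdist y (e i) < r.

Let quant_ex n y : exists i, mdist y (e i) < n.+1%:R^-1.
Proof. by apply: eP; rewrite invr_gt0 ltr0n. Qed.

(** Taking the least index makes this choice of a nearby dense point measurable. *)
Definition quant n y : nat := ex_minn (quant_ex n y).

Lemma quant_lt n y : mdist y (e (quant n y)) < n.+1%:R^-1.
Proof. by rewrite /quant; case: ex_minnP. Qed.

Lemma measurable_quant n i : measurable ([set y | quant n y = i] : set (borel E)).
Proof.
pose B i : set (borel E) := [set y | mdist (y : E) (e i) < n.+1%:R^-1].
have mB j : measurable (B j) by apply: sub_sigma_algebra; exact: open_mdist_lt.
rewrite (_ : mkset _ = B i `\` \big[setU/set0]_(j < i) B j).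
  apply: measurableD => //; exact: bigsetU_measurable.
apply/seteqP; split=> y /=.
  move=> <-; split; first exact: quant_lt.
  rewrite /quant; case: ex_minnP => m ym mmin.
  rewrite -bigcup_mkord => -[j /= jm]; rewrite /B/= => /mmin.
  by rewrite leqNgt jm.
move=> [yi ny]; rewrite /quant; case: ex_minnP => m ym mmin.
apply/eqP; rewrite eqn_leq mmin//= leqNgt; apply/negP => mi.
by apply: ny; rewrite -bigcup_mkord; exists m.
Qed.

Lemma measurable_quant_comp d (Om : measurableType d) (f : Om -> E) n i :
  measurable_fun setT (f : Om -> borel E) ->
  measurable [set w | quant n (f w) = i].
Proof.
by move=> mf; have := mf measurableT _ (measurable_quant n i); rewrite setTI.
Qed.

(** Quantizing one argument leaves countably many distances to fixed points, each a Borel function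
    of the other argument; this is where separability enters. *)
Lemma measurable_mdist d (Om : measurableType d) (f g : Om -> E) :
  measurable_fun setT (f : Om -> borel E) ->
  measurable_fun setT (g : Om -> borel E) ->
  measurable_fun setT (fun w => mdist (f w) (g w)).
Proof.
move=> mf mg.
apply: (@measurable_fun_cvg _ _ _ _
  (fun n w => mdist (g w) (e (quant n (f w))))).
  move=> n; apply: (@measurable_fun_countable_case _ _ _ _ _
    (fun w => quant n (f w)) (fun i w => mdist (g w) (e i))).
    by move=> i; exact: measurable_quant_comp.
  move=> i; apply: (@measurableT_comp _ _ _ _ (borel E) _
    (fun y => mdist (y : E) (e i)) _ _ _ mg).
  apply: (measurability _ (RGenInftyO.measurableE R)).
  move=> _ [_ [x ->] <-]; rewrite setTI; apply: sub_sigma_algebra.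
  rewrite (_ : _ @^-1` _ = [set y : E | mdist y (e i) < x]).
    exact: open_mdist_lt.
  by apply/seteqP; split => y /=; rewrite in_itv.
move=> w _; apply/cvgrPdist_le => r r0.
near=> n; have nr : n.+1%:R^-1 <= r.
  rewrite -[r]invrK lef_pV2 ?posrE ?invr_gt0 ?ltr0n//.
  rewrite (@le_trans _ _ n%:R) ?ler_nat//.
  near: n; exact: nbhs_infty_ger.
have q := quant_lt n (f w).
have h1 := metric_triangle (f w) (e (quant n (f w))) (g w).
have h2 := metric_triangle (g w) (f w) (e (quant n (f w))).
rewrite [mdist (e _) (g w)]metric_sym in h1.
rewrite [mdist (g w) (f w)]metric_sym in h2.
have {q nr} q := lt_le_trans q nr.
by rewrite ler_norml; apply/andP; split; lra.
Unshelve. all: by end_near. Qed.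

Context (T : R).
Hypothesis T0 : 0 < T.

Definition stepseq N (s : seq nat) : skorokhod E T :=
  step_path T0 N (fun i => e (nth 0%N s i)).

Let code (x : R -> E) N := mkseq (fun i => quant N (x (i%:R * mesh T N))) N.+2.

Lemma stepseq_code (x : skorokhod E T) r : 0 < r ->
  \forall N \near \oo, ball x r (stepseq N (code x N)).
Proof.
move=> r0; have [N0 HN0] := step_path_ball T0 x r0.
near=> N; apply: HN0; first by near: N; exact: nbhs_infty_ge.
move=> i iN; rewrite nth_mkseq//; apply: le_trans (ltW (quant_lt N _)) _.
rewrite -[r / 4]invrK lef_pV2 ?posrE ?invr_gt0 ?divr_gt0 ?ltr0n//.
rewrite (@le_trans _ _ N%:R) ?ler_nat//.
near: N; exact: nbhs_infty_ger.
Unshelve. all: by end_near. Qed.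

Lemma skorokhod_dense (x : skorokhod E T) r : 0 < r ->
  exists i : nat * seq nat, ball x r (stepseq i.1 i.2).
Proof.
move=> r0; have [N _ /(_ N (leqnn N)) xN] := stepseq_code x r0.
by exists (N, code x N).
Qed.

(** Every path is the Skorokhod limit of its quantized step paths, which take countably many values
    and depend only on the coordinates at grid times. *)
Lemma measurable_process d (Om : measurableType d) (X : Om -> skorokhod E T) :
  is_process X -> measurable_fun setT (X : Om -> borel (skorokhod E T)).
Proof.
move=> Xp; apply: (@measurable_borel_cvg _ _ _ _
  (fun N w => stepseq N (code (X w) N))); last first.
  by move=> w; apply/cvg_ballP => r r0; exact: stepseq_code.
move=> N; apply: (@measurable_fun_countable_case _ _ _ (borel (skorokhod E T)) _
  (fun w => code (X w) N) (fun s w => stepseq N s)) => //.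
(* Induction on the length of a prefix of the code; the bound by N + 2 keeps the sampled times in
   [0, T]. *)
rewrite /code; have : (N.+2 <= N.+2)%N by [].
elim: {1 3}N.+2 => [_|k ih kN] s.
  rewrite /mkseq/=; case: s => [|a s].
    by rewrite (_ : mkset _ = setT)//; apply/seteqP; split.
  by rewrite (_ : mkset _ = set0)//; apply/seteqP; split.
case/lastP: s => [|s a].
  by rewrite (_ : mkset _ = set0)//; apply/seteqP; split.
rewrite (_ : mkset _ = [set w | mkseq (fun i => quant N (X w (i%:R * mesh T N))) k = s] `&`
  [set w | quant N (X w (k%:R * mesh T N)) = a]).
  apply: measurableI; first by apply: ih; exact: ltnW.
  apply: measurable_quant_comp; apply: Xp.
  rewrite /= in_itv/= mulr_ge0 ?ler0n ?(ltW (mesh_gt0 T0 N))//=.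
  by rewrite mulrC -ler_pdivlMl ?mesh_gt0// invf_div divfK ?gt_eqF// ler_nat.
apply/seteqP; split=> w /=; rewrite mkseqS.
  by move=> /eqP; rewrite eqseq_rcons => /andP[/eqP-> /eqP->].
by move=> [-> ->].
Qed.

End separable_metric.

(** * Kept length, its inverse, and paths at random times *)

Section measurable_deletion.
Context (R : realType) d (Om : measurableType d).
Context (tau sigma : nat -> Om -> R).
Hypothesis mtau : forall k, measurable_fun setT (tau k).
Hypothesis msigma : forall k, measurable_fun setT (sigma k).
Hypothesis del : forall w, deletion_times (tau ^~ w) (sigma ^~ w).

Let L w := kept_length (tau ^~ w) (sigma ^~ w).
Let A w := kept_inverse (tau ^~ w) (sigma ^~ w).

Lemma measurable_kept (ta si : nat -> R) : measurable (kept ta si).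
Proof. by apply: bigcup_measurable => k _; exact: measurable_itv. Qed.

Lemma kept_lengthE (ta si : nat -> R) t :
  kept_length ta si t = fine (lebesgue_measure (kept ta si `&` `[0, t])).
Proof.
by rewrite /kept_length /Rintegral integral_indic//; exact: measurable_kept.
Qed.

Let kept_fin (ta si : nat -> R) (I : set R) (a b : R) : measurable I -> I `<=` `[a, b] ->
  lebesgue_measure (kept ta si `&` I) \is a fin_num.
Proof.
move=> mI Iab; rewrite ge0_fin_numE//; apply: le_lt_trans (ltry (Num.max (b - a) 0)).
rewrite (@le_trans _ _ (lebesgue_measure (`[a, b] : set R)))//.
  apply: le_measure; rewrite ?inE; [|exact: measurable_itv|by move=> s [_ /Iab]].
  by apply: measurableI; [exact: measurable_kept|exact: mI].
rewrite lebesgue_measure_itv/= lte_fin; case: ifPn => _; last by rewrite lee_fin le_max lexx orbT.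
by rewrite -EFinB lee_fin le_max lexx.
Qed.

Lemma kept_length_sub (ta si : nat -> R) s t : 0 <= s <= t ->
  kept_length ta si s <= kept_length ta si t <= kept_length ta si s + (t - s).
Proof.
move=> /andP[s0 st]; rewrite !kept_lengthE.
have mI a b : measurable (kept ta si `&` `[a, b]%classic).
  by apply: measurableI; [exact: measurable_kept|exact: measurable_itv].
have f r : lebesgue_measure (kept ta si `&` `[0, r]%classic) \is a fin_num.
  by apply: (@kept_fin ta si _ 0 r) => //; exact: measurable_itv.
apply/andP; split.
  apply: fine_le => //; apply: le_measure; rewrite ?inE; [exact: mI|exact: mI|].
  by move=> r [kr]; rewrite /= !in_itv/= => /andP[r0 rs]; rewrite r0 (le_trans rs).
rewrite -lee_fin fineK// EFinD fineK//.
apply: (@le_trans _ _ (lebesgue_measure ((kept ta si `&` `[0, s]%classic) `|` `[s, t]%classic))).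
  apply: le_measure; rewrite ?inE; [exact: mI| |].
    by apply: measurableU; [exact: mI|exact: measurable_itv].
  move=> r [kr]; rewrite /= !in_itv/= => /andP[r0 rt].
  by have [rs|sr] := leP r s; [left; split => //; rewrite r0|right; rewrite (ltW sr)].
apply: le_trans (measureU2 _ _ _) _; [exact: mI|exact: measurable_itv|].
rewrite leeD2l// [leLHS]lebesgue_measure_itv/= lte_fin; case: ifPn => _ //.
by rewrite lee_fin subr_ge0.
Qed.

Lemma kept_length_le (ta si : nat -> R) t : 0 <= t ->
  0 <= kept_length ta si t <= t.
Proof.
move=> t0; have s0t : 0 <= (0 : R) <= t by rewrite lexx.
have /andP[] := kept_length_sub ta si s0t.
have -> : kept_length ta si 0 = 0.
  rewrite kept_lengthE set_itv1.
  apply/eqP; rewrite fine_eq0; last first.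
    apply: (@kept_fin ta si _ 0 0) => [|r ->]; first exact: measurable_set1.
    by rewrite /= in_itv/= !lexx.
  rewrite -measure_le0 -(lebesgue_measure_set1 (0 : R)).
  apply: le_measure; rewrite ?inE; [|exact: measurable_set1|by move=> r []].
  by apply: measurableI; [exact: measurable_kept|exact: measurable_set1].
by rewrite subr0 add0r => -> ->.
Qed.

(** The kept length is the measure of a section of a jointly measurable subset of Om x R. *)
Lemma measurable_kept_length t : measurable_fun setT (fun w => L w t).
Proof.
pose C k := [set p : Om * R | sigma k p.1 <= p.2] `&` [set p | p.2 < tau k.+1 p.1].
have mC k : measurable (C k).
  apply: measurableI.
    apply: measurable_comprehension_le => //.
    by apply: measurableT_comp => //; exact: msigma.
  apply: measurable_comprehension_lt => //.
  by apply: measurableT_comp => //; exact: mtau.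
pose B := (\bigcup_k C k) `&` (setT `*` `[0, t]%classic) : set (Om * R).
have mB : measurable B.
  apply: measurableI; first by apply: bigcup_measurable => k _; exact: mC.
  by apply: measurableX => //; exact: measurable_itv.
have := measurable_fun_xsection (@lebesgue_measure R) mB.
have -> : (fun w => L w t) = fine \o (lebesgue_measure \o xsection B).
  apply/funext => w /=; rewrite /L kept_lengthE; congr (fine (lebesgue_measure _)).
  apply/seteqP; split=> s.
    move=> [[k _ /=]]; rewrite in_itv/= => /andP[h1 h2] h3.
    by apply/xsectionP; split; [exists k|split].
  move=> /xsectionP[[k _ [/= h1 h2]] [_ h3]]; split => //.
  by exists k => //=; rewrite in_itv/= h1.
by move=> h; apply: measurableT_comp => //; exact: h.
Qed.

(** The infimum of the empty set is 0, so the direct implication relies on the total kept length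
    being infinite. *)
Lemma kept_inverse_lt (ta si : nat -> R) : deletion_times ta si -> forall t c,
  (kept_inverse ta si t < c <-> exists s, [/\ 0 <= s, s < c & t < kept_length ta si s]).
Proof.
move=> dts t c; split=> [|[s [s0 sc ts]]]; last first.
  exact: le_lt_trans (kept_inverse_le s0 ts) sc.
move=> /inf_lt[|s [s0 ts] sc]; last by exists s.
by have [s] := kept_length_unbounded dts t; exists s.
Qed.

Lemma measurable_kept_inverse t : measurable_fun setT (fun w => A w t).
Proof.
apply: (measurability _ (RGenInftyO.measurableE R)).
move=> _ [_ [c ->] <-]; rewrite setTI.
(* The kept length is nondecreasing, so the witness below [c] can be moved up to a rational. *)
have -> : (fun w => A w t) @^-1` `]-oo, c[%classic =
    \bigcup_(q : rat) [set w : Om | 0 <= (ratr q : R) < c /\ t < L w (ratr q)].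
  apply/seteqP; split=> w /=; rewrite in_itv/=.
    move=> /(kept_inverse_lt (del w))[s [s0 sc ts]].
    have [q] := rat_in_itvoo sc; rewrite in_itv/= => /andP[sq qc].
    exists q => //=; rewrite (le_trans s0 (ltW sq)) qc; split => //.
    apply: lt_le_trans ts _.
    have sq' : 0 <= s <= ratr q by rewrite s0 ltW.
    by case/andP: (kept_length_sub (tau ^~ w) (sigma ^~ w) sq').
  move=> [q _ [/andP[q0 qc] tq]]; apply/(kept_inverse_lt (del w)).
  by exists (ratr q).
apply: bigcupT_measurable_rat => q.
have [qc|qc] := boolP (0 <= (ratr q : R) < c).
  rewrite (_ : mkset _ = [set w | t < L w (ratr q)]).
    by apply: measurable_comprehension_lt => //; exact: measurable_kept_length.
  by apply/seteqP; split=> w /=; [case|].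
by rewrite (_ : mkset _ = set0)//; apply/seteqP; split=> w //= [].
Qed.

(** The lower bound is L(s) <= s. For the upper one, L is 1-Lipschitz and loses less than [a] before
    T + 1, so L(t + a) > t; the extra unit of time leaves room for t + a. *)
Lemma kept_inverse_window (ta si : nat -> R) T a t : deletion_times ta si ->
  0 <= t <= T -> 0 < a < 1 -> T + 1 - kept_length ta si (T + 1) < a ->
  t <= kept_inverse ta si t <= t + a.
Proof.
move=> dts /andP[t0 tT] /andP[a0 a1] small; apply/andP; split.
  rewrite leNgt; apply/negP => /(kept_inverse_lt dts)[s [s0 st]].
  have /andP[_ h] := kept_length_le ta si s0.
  by move=> /lt_le_trans -/(_ _ h); rewrite ltNge ltW.
apply: kept_inverse_le; first by rewrite addr_ge0// ltW.
have : 0 <= t + a <= T + 1.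
  by apply/andP; split; lra.
move=> /(kept_length_sub ta si)/andP[_ ].
by move: small; lra.
Qed.

(** [B] is approximated by grid times strictly to its right, hence the successor in [Bn], and right
    continuity of the paths gives convergence. *)
Lemma is_process_random_time (E : completeMetricType R) (X : Om -> cadlag E `[0, +oo[)
    (B : Om -> R) : is_process X -> measurable_fun setT B -> (forall w, 0 <= B w) ->
  measurable_fun setT (fun w => X w (B w) : borel E).
Proof.
move=> Xp mB B0.
pose k n w := Num.truncn (B w / n.+1%:R^-1).
pose Bn n w := (k n w).+1%:R / n.+1%:R : R.
have n0 n : 0 < n.+1%:R :> R by rewrite ltr0n.
have BBn n w : B w < Bn n w <= B w + n.+1%:R^-1.
  have b0 : 0 <= B w / n.+1%:R^-1 by rewrite divr_ge0// invr_ge0 ltW.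
  have /andP[h1 h2] := truncn_itv b0.
  rewrite /Bn ltr_pdivlMr//; rewrite invrK in h1 h2.
  rewrite -[X in _ < X]/((Num.truncn (B w / n.+1%:R^-1)).+1%:R) invrK h2/=.
  rewrite ler_pdivrMr// mulrDl mulVf ?gt_eqF// /k invrK -natr1 lerD2r//.
apply: (@measurable_borel_cvg _ _ _ _ (fun n w => X w (Bn n w))).
  move=> n; apply: (@measurable_fun_countable_case _ _ _ (borel E) _ (k n)
    (fun i w => X w (i.+1%:R / n.+1%:R))).
    move=> i.
    have := @measurable_comprehension_le _ _ _ _ _ (measurable_cst (i%:R : R)) (measurable_funM mB (measurable_cst (n.+1%:R : R))).
    have := @measurable_comprehension_lt _ _ _ _ _ (measurable_funM mB (measurable_cst (n.+1%:R : R))) (measurable_cst (i.+1%:R : R)).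
    move=> m1 m2; have := measurableI _ _ m2 m1.
    congr measurable; apply/seteqP; split=> w /=; rewrite /k invrK.
      by move=> [h1 h2]; apply: truncn_def; rewrite h1.
    by move=> <-; apply/andP/truncn_itv; rewrite mulr_ge0// ltW.
  by move=> i; apply: Xp; rewrite /= in_itv/= andbT divr_ge0// ltW.
move=> w; have Bw : `[0, +oo[%classic (B w) by rewrite /= in_itv/= B0.
have [xr _] := cadlag_funP (X w) Bw.
apply/cvg_ballP => r r0.
have [e /= e0 eU] := xr _ (nbhsx_ballx _ _ r0).
near=> n; have /andP[h1 h2] := BBn n w; apply: eU => //=.
  rewrite distrC gtr0_norm ?subr_gt0// ltrBlDl (le_lt_trans h2)// ltrD2l.
  rewrite -[e]invrK ltf_pV2 ?posrE ?invr_gt0 ?ltr0n//.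
  rewrite (@le_lt_trans _ _ n%:R) ?ltr_nat//.
  near: n; exact: nbhs_infty_ger.
by rewrite in_itv/= andbT (le_trans (B0 w))// ltW.
Unshelve. all: by end_near. Qed.

End measurable_deletion.

Section restricted_processes.
Context (R : realType) (E : completeMetricType R) d (Om : measurableType d).
Context (X : Om -> cadlag E `[0, +oo[) (Xp : is_process X) (T : R).

Lemma is_process_restrict : is_process (fun w => restrict_path T (X w)).
Proof.
move=> t tT; rewrite (_ : (fun _ => _) = fun w => X w t).
  by apply: Xp; exact: sub_itv0T_itv0y tT.
by apply/funext => w /=; rewrite /patch mem_set.
Qed.

Context (tau sigma : nat -> Om -> R).
Hypothesis mtau : forall k, measurable_fun setT (tau k).
Hypothesis msigma : forall k, measurable_fun setT (sigma k).

Lemma is_process_delete (del : forall w, deletion_times (tau ^~ w) (sigma ^~ w)) :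
  is_process (fun w => delete_path T (X w) (del w)).
Proof.
move=> t tT; rewrite (_ : (fun _ => _) =
    fun w => X w (kept_inverse (tau ^~ w) (sigma ^~ w) t)).
  apply: is_process_random_time => //; first exact: measurable_kept_inverse.
  by move=> w; exact: kept_inverse_ge0.
by apply/funext => w /=; rewrite /patch mem_set.
Qed.

End restricted_processes.

(** * Comparison of a path with its deletion *)

Section modulus_event.
Context (R : realType) (E : completeMetricType R).
Implicit Types (U delta eps : R).

(** Countably many times suffice to witness the modulus: rationals, and [U] itself, coded by [None],
    which has no rationals of [0, U] on its right. *)
Let pt U (p : option rat) : R := if p is Some q then ratr q else U.

Let admissible U delta (pq : option rat * option rat) :=
  [&& 0 <= pt U pq.1 <= U, 0 <= pt U pq.2 <= U &
      `|pt U pq.1 - pt U pq.2| <= delta].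

Let right_ball (f : cadlag E `[0, +oo[) t eta : 0 <= t -> 0 < eta ->
  exists2 r, 0 < r & forall s, t < s -> s < t + r -> mdist (f t) (f s) < eta.
Proof.
move=> t0 eta0; have tI : `[0, +oo[%classic t by rewrite /= in_itv/= t0.
have [fr _] := cadlag_funP f tI.
have [r /= r0 rf] := fr _ (nbhsx_ballx (f t) _ eta0).
exists r => // s ts sr; have : ball (f t) eta (f s).
  apply: rf => //=; first by rewrite distrC gtr0_norm ?subr_gt0// ltrBlDl.
  by rewrite in_itv/= andbT (le_trans t0)// ltW.
by rewrite ballEmdist.
Qed.

(** By right continuity both times can be moved slightly to the right. Moving [s] to [p] strictly
    before [t] makes t - p < delta, which leaves room to move [t] as well even when t - s =
    delta. *)
Let admissible_approx U delta c (f : cadlag E `[0, +oo[) s t : 0 < delta ->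
  0 <= c -> 0 <= s -> s <= t -> t <= U -> t - s <= delta ->
  c < mdist (f s) (f t) ->
  exists2 pq, admissible U delta pq & c < mdist (f (pt U pq.1)) (f (pt U pq.2)).
Proof.
move=> d0 c0 s0 st tU tsd cm.
have {}st : s < t.
  rewrite lt_neqAle st andbT; apply/eqP => e.
  by move: (le_lt_trans c0 cm); rewrite e mdistxx ltxx.
pose eta := (mdist (f s) (f t) - c) / 2.
have eta0 : 0 < eta by rewrite divr_gt0// subr_gt0.
have [r1 r10 rf1] := right_ball f s0 eta0.
have [r2 r20 rf2] := right_ball f (le_trans s0 (ltW st)) eta0.
have s_lt : s < Num.min (s + r1) t by rewrite lt_min ltrDl r10.
have [p] := rat_in_itvoo s_lt.
rewrite in_itv/= lt_min => /and3P[sp pr pt'].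
have fsp := rf1 _ sp pr.
have tri (v : R) : mdist (f t) (f v) < eta -> c < mdist (f (ratr p)) (f v).
  move=> ftv.
  have h1 := metric_triangle (f s) (f (ratr p)) (f t).
  have h2 := metric_triangle (f (ratr p)) (f v) (f t).
  rewrite [mdist (f v) (f t)]metric_sym in h2.
  have : 2 * eta = mdist (f s) (f t) - c by rewrite mulrC divfK.
  lra.
have p0 : 0 <= (ratr p : R) by rewrite (le_trans s0)// ltW.
have pU : (ratr p : R) <= U by rewrite (le_trans _ tU)// ltW.
have U0 : 0 <= U by rewrite (le_trans p0).
have [tU'|tU'] := eqVneq t U.
  exists (Some p, None); last by apply: tri; rewrite tU' mdistxx.
  rewrite /admissible/= p0 pU U0 lexx/= distrC ger0_norm ?subr_ge0//; lra.
have {}tU : t < U by rewrite lt_neqAle tU'.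
have t_lt : t < Num.min (t + r2) (Num.min (ratr p + delta) U).
  by rewrite !lt_min ltrDl r20 tU andbT/=; lra.
have [q] := rat_in_itvoo t_lt.
rewrite in_itv/= !lt_min => /and4P[tq qr qp qU].
exists (Some p, Some q); last by apply: tri; exact: rf2.
rewrite /admissible/= p0 pU (ltW qU)/= andbT; apply/andP; split; first lra.
by rewrite distrC ger0_norm ?subr_ge0; lra.
Qed.

Lemma modulus_ge U delta (f : R -> E) s t : 0 <= s <= U -> 0 <= t <= U ->
  `|s - t| <= delta -> ((mdist (f s) (f t))%:E <= modulus U f delta)%E.
Proof.
by move=> sU tU std; apply: ereal_sup_ubound; exists s, t; split; rewrite ?in_itv.
Qed.

(** The supremum need not be attained, hence the intersection over the levels eps - 1 / (k + 1),
    each of which must be exceeded by some admissible pair. *)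
Lemma measurable_modulus_event d (Om : measurableType d)
    (X : Om -> cadlag E `[0, +oo[) U delta eps : separable E -> is_process X ->
  0 <= U -> 0 < delta ->
  measurable [set w | (eps%:E <= modulus U (X w) delta)%E].
Proof.
move=> sE Xp U0 d0; have [e eP] := dense_seq sE.
pose F k pq := [set w : Om | admissible U delta pq /\
  eps - k.+1%:R^-1 < mdist (X w (pt U pq.1)) (X w (pt U pq.2))].
have mF k pq : measurable (F k pq).
  have [adm|adm] := boolP (admissible U delta pq); last first.
    by rewrite (_ : F _ _ = set0)//; apply/seteqP; split=> w // [] h; rewrite h in adm.
  rewrite (_ : F _ _ =
    [set w | eps - k.+1%:R^-1 < mdist (X w (pt U pq.1)) (X w (pt U pq.2))]); last first.
    by apply/seteqP; split=> w //= [].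
  have /and3P[/andP[p0 _] /andP[q0 _] _] := adm.
  apply: measurable_comprehension_lt => //.
  by apply: (measurable_mdist eP); apply: Xp; rewrite /= in_itv/= andbT.
have -> : [set w | (eps%:E <= modulus U (X w) delta)%E] =
    \bigcap_k \bigcup_pq F k pq.
  apply/seteqP; split=> w /=.
    move=> h k _; set c := eps - k.+1%:R^-1.
    (* A negative level is exceeded by the distance 0 of the pair (U, U). *)
    have [c0|c0] := ltP c 0.
      exists (None, None) => //; split; last by rewrite mdistxx.
      by rewrite /admissible/= subrr normr0 U0 lexx ltW.
    have : (c%:E < modulus U (X w) delta)%E.
      by apply: lt_le_trans h; rewrite lte_fin ltrBlDr ltrDl invr_gt0 ltr0n.
    move=> /ereal_sup_gt[_ [s [t [+ + std ->]]]]; rewrite lte_fin !in_itv/=.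
    move=> /andP[s0 sU] /andP[t0 tU] cm.
    have [st|/ltW ts] := leP s t.
      have [|pq adm cpq] := admissible_approx d0 c0 s0 st tU _ cm.
        by move: std; rewrite distrC ger0_norm ?subr_ge0.
      by exists pq.
    rewrite metric_sym in cm.
    have [|pq adm cpq] := admissible_approx d0 c0 t0 ts sU _ cm.
      by move: std; rewrite ger0_norm ?subr_ge0.
    by exists pq.
  move=> h; apply/lee_addgt0Pr => r r0.
  have [k kr] : exists k, k.+1%:R^-1 <= r.
    exists (Num.truncn r^-1); rewrite -[leRHS]invrK lef_pV2 ?posrE ?invr_gt0//.
    by rewrite ltW// truncnS_gt.
  have [[p q] _ [/and3P[pU qU pq] m]] := h k I.
  apply: (@le_trans _ _ ((mdist (X w (pt U p)) (X w (pt U q)))%:E + r%:E)%E).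
    by rewrite -EFinD lee_fin; move: (k.+1%:R^-1) m kr => c0 /=; lra.
  by rewrite leeD2r//; exact: modulus_ge.
apply: bigcapT_measurable => k; apply: countable_bigcupT_measurable => //.
Qed.

Lemma delete_path_ball T (x : cadlag E `[0, +oo[) (ta si : nat -> R)
    (del : deletion_times ta si) a delta eps e : 0 <= T ->
  0 < a < 1 -> a <= delta -> (modulus (T + 1) x delta < eps%:E)%E ->
  T + 1 - kept_length ta si (T + 1) < a -> eps < e ->
  ball (restrict_path T x) e (delete_path T x del).
Proof.
move=> T0 a01 ad xd small epse; exists eps => //; exists id.
  by split => //; rewrite image_id.
move=> t tT; have := tT; rewrite in_itv/= => tT'; have /andP[t0 tT1] := tT'.
have /andP[tA At] := kept_inverse_window del tT' a01 small.
have /andP[a0 a1] := a01.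
rewrite /= /patch !mem_set//=.
have : ((mdist (x t) (x (kept_inverse ta si t)))%:E <= modulus (T + 1) x delta)%E.
  apply: modulus_ge; [lra|lra|].
  by rewrite distrC ger0_norm ?subr_ge0//; lra.
move=> /le_lt_trans/(_ xd); rewrite lte_fin => h.
split; last exact: ltW.
by rewrite subrr normr0; apply: le_trans (mdist_ge0 _ _) (ltW h).
Qed.

End modulus_event.

(** * Tightness *)

Section unit_valued_bounds.
Context d (Om : measurableType d) (R : realType) (P : probability Om R).
Implicit Types (f g : Om -> R) (A B : set Om).

Lemma le_Rintegral_indic f A : measurable_fun setT f ->
  (forall w, 0 <= f w <= 1) -> measurable A -> (forall w, ~ A w -> f w = 0) ->
  \int[P]_w f w <= fine (P A).
Proof.
move=> mf f01 mA fA.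
have -> : fine (P A) = \int[P]_w (\1_A w : R).
  by rewrite /Rintegral integral_indic// setIT.
apply: le_Rintegral => //; first exact: integrable_unit.
  apply: integrable_unit => [|w]; first exact: measurable_indic.
  by rewrite indicE ler0n lern1 leq_b1.
move=> w _; rewrite indicE; have [Aw|Aw] := pselect (A w).
  by rewrite mem_set//; case/andP: (f01 w).
by rewrite fA// ler0n.
Qed.

Lemma Rintegral_ge1 f : measurable_fun setT f -> (forall w, 0 <= f w <= 1) ->
  fine (P [set w | 1 <= f w]) <= \int[P]_w f w.
Proof.
move=> mf f01; have m1 : measurable [set w | 1 <= f w].
  exact: measurable_comprehension_le.
have -> : fine (P [set w | 1 <= f w]) = \int[P]_w (\1_[set w | 1 <= f w] w : R).
  by rewrite /Rintegral integral_indic// setIT.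
apply: le_Rintegral => //; last 2 first.
- exact: integrable_unit.
- move=> w _; rewrite indicE; have [h|h] := pselect (1 <= f w).
    by rewrite mem_set.
  by rewrite memNset//; case/andP: (f01 w).
apply: integrable_unit => [|w]; first exact: measurable_indic.
by rewrite indicE ler0n lern1 leq_b1.
Qed.

Lemma Rintegral_close f g B eta c : measurable_fun setT f -> measurable_fun setT g ->
  (forall w, 0 <= f w <= 1) -> (forall w, 0 <= g w <= 1) -> measurable B ->
  (P B <= c%:E)%E -> 0 <= eta -> (forall w, ~ B w -> `|f w - g w| <= eta) ->
  `|\int[P]_w f w - \int[P]_w g w| <= eta + c.
Proof.
move=> mf mg f01 g01 mB PB eta0 fg.
have if_ := integrable_unit P mf f01; have ig := integrable_unit P mg g01.
have ifg : P.-integrable setT (EFin \o (fun w => f w - g w)).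
  by have := integrableB measurableT if_ ig; apply: eq_integrable.
rewrite -RintegralB//; apply: le_trans (le_normr_Rintegral measurableT ifg) _.
have iB : P.-integrable setT (EFin \o (\1_B : Om -> R)).
  apply: integrable_unit => [|w]; first exact: measurable_indic.
  by rewrite indicE ler0n lern1 leq_b1.
have ie : P.-integrable setT (EFin \o (cst eta : Om -> R)).
  exact: finite_measure_integrable_cst.
have ieB : P.-integrable setT (EFin \o (fun w => cst eta w + \1_B w)).
  by have := integrableD measurableT ie iB; apply: eq_integrable.
apply: (@le_trans _ _ (\int[P]_w (cst eta w + \1_B w))).
  apply: le_Rintegral => //.
    by have := integrable_norm ifg; apply: eq_integrable.
  move=> w _ /=; rewrite indicE; have [Bw|Bw] := pselect (B w).
    rewrite mem_set//=; apply: (@le_trans _ _ 1); last by rewrite lerDr.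
    have /andP[? ?] := f01 w; have /andP[? ?] := g01 w.
    by rewrite ler_norml; apply/andP; split; lra.
  by rewrite memNset// addr0; exact: fg.
rewrite RintegralD// Rintegral_cst// [X in fine X]probability_setT mulr1.
rewrite lerD2l /Rintegral integral_indic// setIT.
by rewrite -lee_fin fineK// fin_num_measure.
Qed.

End unit_valued_bounds.

Lemma measurable_unif01 d (Om : measurableType d) (R : realType)
    (S : pseudoPMetricType R) (Y : Om -> S) (g : S -> R) :
  measurable_fun setT (Y : Om -> borel S) -> unif01 g ->
  measurable_fun setT (fun w => g (Y w)).
Proof.
move=> mY ug; apply: (@measurableT_comp _ _ _ _ (borel S) _ _ _ _ _ mY).
by apply: continuous_borel; exact: unif01_continuous.
Qed.

Lemma integral_law d (Om : measurableType d) (R : realType) (P : probability Om R)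
    (S : pseudoPMetricType R) (Y : Om -> S) (g : S -> R) :
  measurable_fun setT (Y : Om -> borel S) -> unif01 g ->
  (\int[law P Y]_x (g x)%:E)%E = (\int[P]_w g (Y w))%:E.
Proof.
move=> mY ug; have [g01 _] := ug.
have ig : P.-integrable setT (EFin \o (fun w => g (Y w))).
  by apply: integrable_unit => //; exact: measurable_unif01.
rewrite /law (integral_pushforward mY) ?preimage_setT//.
  by rewrite /Rintegral fineK//; exact: integrable_fin_num.
by apply/measurable_EFinP; apply: continuous_borel; exact: unif01_continuous.
Qed.

(** The centre may depend on [e]; it will be the expectation under X^(alpha) for a small alpha. *)
Lemma cvgn_approx (R : realType) (u : nat -> R) :
  (forall e, 0 < e -> exists c, \forall n \near \oo, `|u n - c| <= e) -> cvgn u.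
Proof.
move=> h; apply: cauchy_cvg; apply: cauchy_exP => e e0.
have e20 : 0 < e / 2 by rewrite divr_gt0.
have [c hc] := h _ e20; exists c.
apply: filterS hc => n; rewrite /= /ball/= distrC => /le_lt_trans; apply.
by rewrite ltr_pdivrMr// ltr_pMr// ltr1n.
Qed.

Lemma ultra_exists_lt (T : Type) (U : set_system T) {FU : UltraFilter U}
    (M : nat) (A : nat -> set T) :
  U [set x | exists2 i, (i < M)%N & A i x] -> exists i, U (A i).
Proof.
elim: M => [|M ih] UM.
  have : U set0 by apply: filterS UM => x [].
  by move/filter_not_empty.
have [UA|UA] := in_ultra_setVsetC (A M) FU; first by exists M.
apply: ih; apply: filterS2 UA UM => x nA [i]; rewrite ltnS leq_eqVlt => /orP[/eqP->//|iM Ai].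
by exists i.
Qed.

(** * Uniform cluster points of paths with controlled modulus *)

Section precompactness.
Context (R : realType) (E : completeMetricType R) (T : R).
Context (c : nat -> skorokhod E T).

(** Two paths in one ball are at Skorokhod distance below 6 r. The bound by [delta] lets the modulus
    undo the time change, and the bound by [rho] then makes the paths uniformly 2 [rho]-close. *)
Definition nearly_equicontinuous (rho : R) (K : set (skorokhod E T)) :=
  exists delta r M, [/\ 0 < delta, 0 < r, 6 * r <= delta, 6 * r <= rho &
    forall x, K x ->
      (forall s t, s \in `[0, T] -> t \in `[0, T] -> `|s - t| <= delta ->
         mdist (x s) (x t) <= rho) /\
      exists2 i, (i < M)%N & ball (c i) (3 * r) x].

(** An ultrafilter finer than the tails selects one ball of each finite cover, in place of a
    diagonal extraction. Along it the paths are uniformly Cauchy, so they converge uniformly to a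
    continuous path, which is a cluster point of the sequence. *)
Lemma nearly_equicontinuous_cluster (K : nat -> set (skorokhod E T))
    (rho : nat -> R) (u : nat -> skorokhod E T) :
  (forall e, 0 < e -> exists j, rho j <= e) ->
  (forall j, nearly_equicontinuous (rho j) (K j)) ->
  (forall N j, (j < N)%N -> K j (u N)) ->
  exists x, cluster (u @ \oo) x.
Proof.
move=> rho0 goodK Ku.
have [U [UU ooU]] := @ultraFilterLemma _ \oo _.
have close j : exists delta A, [/\ 0 < delta, U A,
    forall N, A N -> forall s t, s \in `[0, T] -> t \in `[0, T] ->
      `|s - t| <= delta -> mdist (u N s) (u N t) <= rho j &
    forall N N', A N -> A N' -> forall t, t \in `[0, T] ->
      mdist (u N t) (u N' t) <= rho j + rho j].
  have [delta [r [M [d0 r0 rd rrho good]]]] := goodK j.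
  have Uj : U [set N | (j < N)%N] by apply: ooU; exists j.+1.
  have [i Ui] : exists i, U [set N | ball (c i) (3 * r) (u N)].
    apply: (@ultra_exists_lt _ U _ M); apply: filterS Uj => N /= jN.
    by have [_ []] := good _ (Ku N j jN) => i iM ci; exists i.
  exists delta, ([set N | (j < N)%N] `&` [set N | ball (c i) (3 * r) (u N)]).
  split => //; first exact: filterI.
    by move=> N [jN _]; have [] := good _ (Ku N j jN).
  move=> N N' [_ cN] [jN' cN'] t tT.
  have [modN' _] := good _ (Ku N' j jN').
  have [q q6 [l [_ lT] lq]] := ball_triangle (ball_sym cN) cN'.
  have [lt1 lt2] := lq t tT.
  have ltT : l t \in `[0, T] by have : (l @` `[0, T]) (l t) by [exists t]; rewrite lT.
  apply: le_trans (metric_triangle _ (u N' (l t)) _) _; apply: lerD; first lra.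
  by apply: modN' => //; lra.
have lim_ex t : exists y : E, t \in `[0, T] -> u N t @[N --> U] --> y.
  have [tT|_] := boolP (t \in `[0, T]); last by exists point.
  suff : cvg (u N t @[N --> U]) by move=> /cvg_ex[y uy]; exists y.
  apply: cauchy_cvg; apply: cauchy_exP => e e0.
  have e30 : 0 < e / 3 by rewrite divr_gt0.
  have [j je] := rho0 _ e30.
  have [delta [A [_ UA _ Acl]]] := close j.
  have [N AN] := filter_ex UA.
  exists (u N t); suff : U [set N' | ball (u N t) e (u N' t)] by [].
  apply: filterS UA => N' AN'; rewrite /= ballEmdist/=.
  by apply: le_lt_trans (Acl _ _ AN AN' _ tT) _; lra.
have [x xP] := choice lim_ex.
have ux j : exists delta A, [/\ 0 < delta, U A,
    forall N, A N -> forall s t, s \in `[0, T] -> t \in `[0, T] ->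
      `|s - t| <= delta -> mdist (u N s) (u N t) <= rho j &
    forall N, A N -> forall t, t \in `[0, T] -> mdist (u N t) (x t) <= 3 * rho j].
  have [delta [A [d0 UA Amod Acl]]] := close j.
  exists delta, A; split => // N AN t tT.
  have rj : 0 < rho j.
    by have [? [r [_ [_ r0 _ rr _]]]] := goodK j; apply: lt_le_trans rr; rewrite mulr_gt0.
  have Ut : U [set N' | ball (x t) (rho j) (u N' t)].
    exact: xP _ tT _ (nbhsx_ballx (x t) _ rj).
  have [N' [AN' ]] := filter_ex (filterI UA Ut).
  rewrite /= ballEmdist/= => xN'.
  have := Acl _ _ AN AN' _ tT; have := metric_triangle (u N t) (u N' t) (x t).
  rewrite [mdist (u N' t) (x t)]metric_sym; lra.
have xmod e : 0 < e -> exists2 delta, 0 < delta & forall s t,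
    s \in `[0, T] -> t \in `[0, T] -> `|s - t| <= delta -> mdist (x s) (x t) <= e.
  (* The oscillation of [x] is at most 7 [rho j]: twice 3 [rho j] for the passage to [u N], and
     [rho j] for its modulus. *)
  move=> e0; have e80 : 0 < e / 8 by rewrite divr_gt0.
  have [j je] := rho0 _ e80; have [delta [A [d0 UA Amod Acl]]] := ux j.
  have [N AN] := filter_ex UA; exists delta => // s t sT tT std.
  have h1 := metric_triangle (x s) (u N s) (x t).
  have h2 := metric_triangle (u N s) (u N t) (x t).
  have h3 := Acl N AN _ sT; rewrite metric_sym in h3.
  have h4 := Acl N AN _ tT; have h5 := Amod N AN _ _ sT tT std.
  lra.
have xc : cadlag_on `[0, T] x.
  have xcont t (F : set_system R) : t \in `[0, T] -> Filter F -> F --> t ->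
      x s @[s --> within `[0, T] F] --> x t.
    move=> tT FF Ft; apply/cvg_ballP => e e0.
    have e20 : 0 < e / 2 by rewrite divr_gt0.
    have [delta d0 xd] := xmod _ e20.
    rewrite near_withinE.
    have : \forall s \near F, `|t - s| < delta by move: Ft => /cvgrPdist_lt; exact.
    apply: filterS => s ts sT; rewrite ballEmdist/=.
    by apply: le_lt_trans (xd _ _ tT sT (ltW ts)) _; lra.
  move=> t tT; split.
    by apply: xcont => //; exact: cvg_within.
  by exists (x t); apply: xcont => //; exact: cvg_within.
exists (to_cadlag xc) => A B uA /nbhs_ballP[e /= e0 eB].
have e40 : 0 < e / 4 by rewrite divr_gt0.
have [j je] := rho0 _ e40; have [delta [C [d0 UC Cmod Ccl]]] := ux j.
have [N [CN AN]] := filter_ex (filterI UC (ooU _ uA)).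
exists (u N); split => //; apply: eB.
exists (3 * (e / 4)); first lra.
exists id; first by split => //; rewrite image_id.
move=> t tT; rewrite subrr normr0; split; first lra.
rewrite /= /patch mem_set// metric_sym (le_trans (Ccl N CN t tT))//.
by rewrite ler_pM2l.
Qed.

End precompactness.

(** * The limit theorem *)

Section deletion_limit.
Context (R : realType) (E : completeMetricType R) (E_separable : separable E)
  (T : R) (T_gt0 : 0 < T)
  (d : nat -> measure_display) (Om : forall n, measurableType (d n))
  (P : forall n, probability (Om n) R)
  (X : forall n, Om n -> cadlag E `[0, +oo[)
  (X_process : forall n, is_process (@X n))
  (X_modulus : forall eps : R, 0 < eps ->
    exists2 delta : R, 0 < delta & exists n0 : nat, forall n, (n0 <= n)%N ->
      (P n [set w | (eps%:E <= modulus (T + 1)%R (@X n w) delta)%E]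
        <= eps%:E)%E)
  (tau sigma : forall n, R -> nat -> {RV (P n) >-> R})
  (tau_sigma : forall n (alpha : R), 0 < alpha < 1 -> forall w,
    deletion_times (fun k => tau n alpha k w) (fun k => sigma n alpha k w))
  (d' : R -> measure_display) (Om' : forall alpha : R, measurableType (d' alpha))
  (Q : forall alpha : R, probability (Om' alpha) R)
  (Xlim : forall alpha : R, Om' alpha -> skorokhod E T)
  (Xlim_process : forall alpha : R, 0 < alpha < 1 -> is_process (@Xlim alpha))
  (deleted_small : forall alpha : R, 0 < alpha < 1 ->
    exists n0 : nat, forall n, (n0 <= n)%N ->
      (P n [set w | (alpha <= T + 1 -
          kept_length (fun k => tau n alpha k w) (fun k => sigma n alpha k w)
            (T + 1))%R] <= alpha%:E)%E)
  (deleted_cvg : forall (alpha : R) (alpha01 : 0 < alpha < 1),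
    weak_cvg \oo
      (fun n => law (P n)
        (fun w => delete_path T (@X n w) (@tau_sigma n alpha alpha01 w)))
      (law (Q alpha) (@Xlim alpha))).

Local Notation S := (skorokhod E T).
Let Y n w := restrict_path T (@X n w).
Let Z n alpha alpha01 w := delete_path T (@X n w) (@tau_sigma n alpha alpha01 w).

Let mY n : measurable_fun setT (@Y n : Om n -> borel S).
Proof.
have [e eP] := dense_seq E_separable; apply: (measurable_process eP T_gt0).
exact: is_process_restrict.
Qed.

Let mZ n alpha alpha01 :
  measurable_fun setT (@Z n alpha alpha01 : Om n -> borel S).
Proof.
have [e eP] := dense_seq E_separable; apply: (measurable_process eP T_gt0).
apply: (is_process_delete (@X_process n)
  (tau := fun k w => tau n alpha k w) (sigma := fun k w => sigma n alpha k w)).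
  by move=> k; exact: measurable_funP.
by move=> k; exact: measurable_funP.
Qed.

Let mXlim alpha : 0 < alpha < 1 ->
  measurable_fun setT (@Xlim alpha : Om' alpha -> borel S).
Proof.
move=> alpha01; have [e eP] := dense_seq E_separable.
by apply: (measurable_process eP T_gt0); exact: Xlim_process.
Qed.

Let m_modulus n eps delta : 0 < delta ->
  measurable [set w | (eps%:E <= modulus (T + 1)%R (@X n w) delta)%E].
Proof.
by move=> d0; apply: measurable_modulus_event => //; rewrite addr_ge0// ltW.
Qed.

Let compare eta e : 0 < eta -> 0 < e -> exists2 alpha0, 0 < alpha0 &
  forall alpha (alpha01 : 0 < alpha < 1), alpha < alpha0 ->
  \forall n \near \oo, exists B, [/\ measurable B, (P n B <= eta%:E)%E &
    forall w, ~ B w -> ball (@Y n w) e (@Z n alpha alpha01 w)].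
Proof.
(* [eps] bounds both the modulus and the probability that it is large, hence its two constraints.
   Below, [alpha] is kept under [delta] so that the time shift stays within the modulus scale, and
   under eta / 2 to bound the probability of a long deletion. *)
move=> eta0 e0; pose eps := Num.min (eta / 2) (e / 2).
have eps0 : 0 < eps by rewrite lt_min !divr_gt0.
have eps1 : eps <= eta / 2 by rewrite ge_min lexx.
have eps2 : eps < e.
  by apply: (@le_lt_trans _ _ (e / 2)); [rewrite ge_min lexx orbT|lra].
have [delta d0 [n0 modn0]] := X_modulus eps0.
exists (Num.min delta (eta / 2)); first by rewrite lt_min d0 divr_gt0.
move=> alpha alpha01; rewrite lt_min => /andP[/ltW ad /ltW ae].
have [n1 smalln1] := deleted_small alpha01.
exists (maxn n0 n1) => // n /=; rewrite geq_max => /andP[/modn0 mod_n /smalln1 small_n].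
set B0 := [set w | _] in mod_n; set B1 := [set w | _] in small_n.
have mB0 : measurable B0 by exact: m_modulus.
have mB1 : measurable B1.
  apply: measurable_comprehension_le => //; apply: measurable_funB => //.
  by apply: (@measurable_kept_length _ _ _ (fun k w => tau n alpha k w)
    (fun k w => sigma n alpha k w)) => k; exact: measurable_funP.
exists (B0 `|` B1); split; first exact: measurableU.
  apply: le_trans (measureU2 _ mB0 mB1) _.
  apply: le_trans (leeD mod_n small_n) _.
  by rewrite -EFinD lee_fin (splitr eta) lerD.
move=> w /not_orP[nB0 nB1].
apply: (@delete_path_ball _ _ _ _ _ _ _ alpha delta eps) => //.
- exact: ltW.
- by rewrite ltNge; apply/negP.
- by rewrite ltNge; apply/negP.
Qed.

Let a (g : S -> R) n := \int[P n]_w g (@Y n w).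
Let c (g : S -> R) alpha := \int[Q alpha]_w g (@Xlim alpha w).

Let deleted_test_cvg alpha (alpha01 : 0 < alpha < 1) (g : S -> R) : unif01 g ->
  (fun n => \int[P n]_w g (@Z n alpha alpha01 w)) @ \oo --> c g alpha.
Proof.
move=> ug; have [g01 _] := ug.
have := deleted_cvg alpha01 (unif01_continuous ug).
have bg : [bounded g x | x in setT].
  exists 1; split => // M M1 x _ /=; have /andP[g0 g1] := g01 x.
  by rewrite ger0_norm// (le_trans g1)// ltW.
move=> /(_ bg); rewrite integral_law//; last exact: mXlim.
have -> : (fun n => (\int[law (P n) (@Z n alpha alpha01)]_x (g x)%:E)%E) =
    EFin \o (fun n => \int[P n]_w g (@Z n alpha alpha01 w)).
  by apply/funext => n; rewrite integral_law//; exact: mZ.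
by move=> /fine_cvgP[].
Qed.

(** X_n^(alpha) is the intermediate term: one third of [eta] for its weak convergence, one for
    uniform continuity of [g], one for the exceptional event. *)
Let test_close g : unif01 g -> forall eta, 0 < eta -> exists2 alpha0, 0 < alpha0 &
  forall alpha, 0 < alpha < 1 -> alpha < alpha0 ->
  \forall n \near \oo, `|a g n - c g alpha| <= eta.
Proof.
move=> ug eta eta0; have [g01 unifg] := ug.
have eta30 : 0 < eta / 3 by rewrite divr_gt0.
have [e e0 ge] := unifg _ eta30.
have [alpha0 alpha00 cmp] := compare eta30 e0.
exists alpha0 => // alpha alpha01 /(cmp _ alpha01) nearB.
have /cvgrPdist_le/(_ _ eta30) nearc := deleted_test_cvg alpha01 ug.
near=> n.
have [B [mB PB ballB]] : exists B, [/\ measurable B, (P n B <= (eta / 3)%:E)%E &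
    forall w, ~ B w -> ball (@Y n w) e (@Z n alpha alpha01 w)] by near: n.
have h1 : `|c g alpha - \int[P n]_w g (@Z n alpha alpha01 w)| <= eta / 3.
  by near: n.
have h2 : `|a g n - \int[P n]_w g (@Z n alpha alpha01 w)| <= eta / 3 + eta / 3.
  apply: (@Rintegral_close _ _ _ _ _ _ B) => //.
  - exact: measurable_unif01.
  - by apply: measurable_unif01 => //; exact: mZ.
  - exact: ltW.
  - by move=> w Bw; apply: ge; exact: ballB.
move: h1 h2; rewrite !ler_norml => /andP[h1 h2] /andP[h3 h4].
by apply/andP; split; lra.
Unshelve. all: by end_near. Qed.

Let a_cvg g : unif01 g -> cvgn (a g).
Proof.
move=> ug; apply: cvgn_approx => eta eta0.
have [alpha0 alpha00 h] := test_close ug eta0.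
pose alpha := Num.min alpha0 1 / 2.
have m0 : 0 < Num.min alpha0 1 by rewrite lt_min alpha00 ltr01.
have m1 : Num.min alpha0 1 <= 1 by rewrite ge_min lexx orbT.
have m2 : Num.min alpha0 1 <= alpha0 by rewrite ge_min lexx.
exists (c g alpha); apply: h; rewrite /alpha; last lra.
by apply/andP; split; lra.
Qed.

Let c_cvg g : unif01 g -> c g alpha @[alpha --> 0^'+] --> limn (a g).
Proof.
move=> ug; apply/cvgrPdist_le => eta eta0.
have [alpha0 alpha00 h] := test_close ug eta0.
near=> alpha.
have alpha01 : 0 < alpha < 1.
  by apply/andP; split; near: alpha; [exact: nbhs_right_gt|exact: nbhs_right_lt].
have aa0 : alpha < alpha0 by near: alpha; exact: nbhs_right_lt.
have near_n := h _ alpha01 aa0.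
have /= : (fun n => `|a g n - c g alpha|) @ \oo --> `|limn (a g) - c g alpha|.
  by apply: cvg_norm; apply: cvgB; [exact: a_cvg|exact: cvg_cst].
move=> lim_norm; rewrite -(cvg_lim _ lim_norm)//; apply: limr_le => //.
exact: cvgP lim_norm.
Unshelve. all: by end_near. Qed.

Let dense_paths : exists q : nat -> S, forall x r, 0 < r -> exists i, ball (q i) r x.
Proof.
have [e eP] := dense_seq E_separable.
pose q n := if @unpickle (nat * seq nat)%type n is Some i
  then stepseq e T_gt0 i.1 i.2 else point.
exists q => x r r0; have [i xi] := skorokhod_dense eP T_gt0 x r0.
by exists (pickle i); rewrite /q pickleK; exact: ball_sym.
Qed.

(** The law of X^(alpha), for a single small alpha, gives most of its mass to finitely many balls
    around a dense sequence. Weak convergence passes this to X_n^(alpha) through a ramp, and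
    [compare] to X_n; each passage enlarges the radius by [r]. *)
Let tight_step (q : nat -> S) (eta rho : R) :
  (forall x r, 0 < r -> exists i, ball (q i) r x) -> 0 < eta -> 0 < rho ->
  exists2 K : set S, nearly_equicontinuous q rho K &
    \forall n \near \oo, exists B, [/\ measurable B, (P n B <= eta%:E)%E &
      forall w, ~ B w -> K (@Y n w)].
Proof.
move=> qP eta0 rho0.
pose eps := Num.min (eta / 4) rho.
have eta40 : 0 < eta / 4 by rewrite divr_gt0.
have eps0 : 0 < eps by rewrite lt_min eta40.
have eps1 : eps <= eta / 4 by rewrite ge_min lexx.
have eps2 : eps <= rho by rewrite ge_min lexx orbT.
have [delta d0 [n0 modn0]] := X_modulus eps0.
(* The bound by 1 keeps [r] in the range where the truncated distance is faithful. *)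
pose r := Num.min (Num.min delta rho) 1 / 6.
have min0 : 0 < Num.min (Num.min delta rho) 1 by rewrite !lt_min d0 rho0 ltr01.
have r0 : 0 < r by rewrite divr_gt0.
have r6 : 6 * r = Num.min (Num.min delta rho) 1 by rewrite /r; lra.
have r1 : r <= 1.
  have : Num.min (Num.min delta rho) 1 <= 1 by rewrite ge_min lexx orbT.
  lra.
have [alpha0 alpha00 cmp] := compare eta40 r0.
pose alpha := Num.min alpha0 1 / 2.
have ma0 : 0 < Num.min alpha0 1 by rewrite lt_min alpha00 ltr01.
have ma1 : Num.min alpha0 1 <= 1 by rewrite ge_min lexx orbT.
have ma2 : Num.min alpha0 1 <= alpha0 by rewrite ge_min lexx.
have alpha01 : 0 < alpha < 1 by rewrite /alpha; apply/andP; split; lra.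
have aa0 : alpha < alpha0 by rewrite /alpha; lra.
have {aa0}cmp := cmp alpha alpha01 aa0.
(* Interiors make [O M] open, hence Borel; a point within r / 2 of a centre still lies in the
   interior of the ball of radius [r]. *)
pose O M : set S := \bigcup_(i < M) interior (ball (q i) r).
have oO M : open (O M) by apply: bigcup_open => i _; exact: open_interior.
have mO M : measurable (@Xlim alpha @^-1` O M).
  by apply: measurable_preimage => //; exact: mXlim.
have OT : \bigcup_M (@Xlim alpha @^-1` O M) = setT.
  apply/seteqP; split=> // w _; have r20 : 0 < r / 2 by rewrite divr_gt0.
  have [i qi] := qP (@Xlim alpha w) _ r20.
  exists i.+1 => //; exists i => //=; apply/nbhs_ballP; exists (r / 2) => //=.
  by move=> y xy; apply: ball_split qi xy.
have [M QM] : exists M, fine (Q alpha (@Xlim alpha @^-1` (~` O M))) <= eta / 4.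
  have ndO : nondecreasing_seq (fun M => @Xlim alpha @^-1` O M).
    move=> m n mn; apply/subsetPset => w [i /= im wi]; exists i => //=.
    exact: leq_trans im mn.
  have := nondecreasing_cvg_mu mO _ ndO; rewrite OT => /(_ _ (Q alpha) measurableT).
  rewrite [X in _ --> X]probability_setT => /fine_cvgP[_ /cvgrPdist_le/(_ _ eta40)].
  move=> [M _ /(_ M (leqnn M))/= hM]; exists M.
  rewrite preimage_setC [X in fine X]probability_setC; last exact: mO.
  rewrite fineB//; last by apply: fin_num_measure; exact: mO.
  by apply: le_trans hM; exact: ler_norm.
pose k := Num.truncn r^-1.
have kr : k.+1%:R^-1 <= r.
  by rewrite -[leRHS]invrK lef_pV2 ?posrE ?invr_gt0// ltW// truncnS_gt.
pose g := ramp k (O M).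
have ug : unif01 g by exact: unif01_ramp.
have [g01 _] := ug.
have cg : c g alpha <= eta / 4.
  apply: le_trans QM; apply: le_Rintegral_indic => //.
  - by apply: measurable_unif01 => //; exact: mXlim.
  - by rewrite preimage_setC; apply: measurableC; exact: mO.
  - by move=> w; rewrite /preimage/= => /contrapT; exact: ramp_in.
have g_lt1 x : g x < 1 -> exists2 i, (i < M)%N & ball (q i) (2 * r) x.
  move=> gx1; have /tdist_lt[] : tdist (O M) x < r.
  - apply: lt_le_trans kr; rewrite ltNge; apply/negP => /ramp1 gx.
    by move: gx1; rewrite /g gx ltxx.
  - exact: r1.
  move=> y [i /= iM /interior_subset qiy] xy; exists i => //.
  by rewrite mulr_natl mulr2n; apply: ball_triangle qiy (ball_sym xy).
exists [set x : S | (forall s t, s \in `[0, T] -> t \in `[0, T] -> `|s - t| <= delta ->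
         mdist (x s) (x t) <= rho) /\
      exists2 i, (i < M)%N & ball (q i) (3 * r) x].
  exists delta, r, M; split => //; rewrite r6; last by rewrite !ge_min lexx orbT.
  by rewrite !ge_min lexx.
have /cvgrPdist_le/(_ _ eta40) nearc := deleted_test_cvg alpha01 ug.
near=> n.
have [B [mB PB ballB]] : exists B, [/\ measurable B, (P n B <= (eta / 4)%:E)%E &
    forall w, ~ B w -> ball (@Y n w) r (@Z n alpha alpha01 w)] by near: n.
have mod_n : (P n [set w | (eps%:E <= modulus (T + 1)%R (@X n w) delta)%E]
    <= eps%:E)%E.
  by apply: modn0; near: n; exact: nbhs_infty_ge.
set B0 := [set w | _] in mod_n.
have mB0 : measurable B0 by exact: m_modulus.
have mgZ : measurable_fun setT (fun w => g (@Z n alpha alpha01 w)).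
  by apply: measurable_unif01 => //; exact: mZ.
(* By Markov's inequality its probability is at most the integral of the ramp, within eta / 4 of a
   limit that is itself at most eta / 4. Off [B1] the deleted path is within [r] of [O M]. *)
pose B1 := [set w | 1 <= g (@Z n alpha alpha01 w)].
have mB1 : measurable B1 by exact: measurable_comprehension_le.
have PB1 : (P n B1 <= (eta / 2)%:E)%E.
  rewrite -[leLHS]fineK ?fin_num_measure// lee_fin.
  apply: le_trans (Rintegral_ge1 (P n) mgZ (fun w => g01 _)) _.
  have : `|c g alpha - \int[P n]_w g (@Z n alpha alpha01 w)| <= eta / 4.
    by near: n.
  by rewrite ler_norml => /andP[h _]; lra.
exists (B0 `|` B `|` B1); split.
- by apply: measurableU => //; exact: measurableU.
- apply: le_trans (measureU2 _ _ mB1) _; first exact: measurableU.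
  apply: le_trans (leeD (measureU2 _ mB0 mB) PB1) _.
  apply: le_trans (leeD (leeD mod_n PB) (lexx _)) _.
  by rewrite -!EFinD lee_fin; lra.
move=> w /not_orP[/not_orP[nB0 nB] nB1]; split.
  move=> s t sT tT std; rewrite /Y/= /patch !mem_set//=.
  have le_T1 v : v \in `[0, T] -> 0 <= v <= T + 1.
    by rewrite in_itv/= => /andP[-> vT]/=; lra.
  have := modulus_ge (@X n w) (le_T1 _ sT) (le_T1 _ tT) std.
  have : (modulus (T + 1) (@X n w) delta < eps%:E)%E.
    by rewrite ltNge; apply/negP.
  by move=> /[swap] /le_lt_trans h /h; rewrite lte_fin => /ltW/le_trans; apply.
have [|i iM qi] := g_lt1 (@Z n alpha alpha01 w); first by rewrite ltNge; apply/negP.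
exists i => //; rewrite (_ : 3 * r = 2 * r + r); last by ring.
by apply: ball_triangle qi _; apply: ball_sym; exact: ballB.
Unshelve. all: by end_near. Qed.

(** Constraint [j] has accuracy 1 / (j + 1) and failure probability at most [eps] / 2^(j + 1),
    eventually in [n]. *)
Let tight eps : 0 < eps -> exists K : nat -> set S,
  (forall N, \forall n \near \oo, exists B, [/\ measurable B,
     (P n B <= eps%:E)%E &
     forall w, ~ B w -> forall j, (j < N)%N -> K j (@Y n w)]) /\
  (forall u : nat -> S, (forall N j, (j < N)%N -> K j (u N)) ->
     exists x, cluster (u @ \oo) x).
Proof.
move=> eps0; have [q qP] := dense_paths.
have Kex j : exists K : set S, nearly_equicontinuous q (j.+1%:R^-1 : R) K /\
    \forall n \near \oo, exists B, [/\ measurable B,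
      (P n B <= (eps * 2^-1 ^+ j.+1)%:E)%E & forall w, ~ B w -> K (@Y n w)].
  have [||K K1 K2] := @tight_step q (eps * 2^-1 ^+ j.+1) j.+1%:R^-1 qP.
  - by rewrite mulr_gt0// exprn_gt0.
  - by rewrite invr_gt0.
  by exists K.
have [K KP] := choice Kex.
exists K; split; last first.
  move=> u Ku; apply: (@nearly_equicontinuous_cluster _ _ _ q K (fun j => j.+1%:R^-1)) => //.
    move=> e e0; exists (Num.truncn e^-1).
    by rewrite -[leRHS]invrK lef_pV2 ?posrE ?invr_gt0// ltW// truncnS_gt.
  by move=> j; case: (KP j).
move=> N.
(* The exact partial sum of the geometric budget makes the induction close. *)
suff : \forall n \near \oo, exists B, [/\ measurable B,
     (P n B <= (eps * (1 - 2^-1 ^+ N))%:E)%E &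
     forall w, ~ B w -> forall j, (j < N)%N -> K j (@Y n w)].
  apply: filterS => n [B [mB PB KB]]; exists B; split => //.
  apply: le_trans PB _; rewrite lee_fin.
  have z0 : 0 <= (2^-1 : R) ^+ N by rewrite exprn_ge0// invr_ge0.
  by apply: ler_piMr; [exact: ltW|lra].
elim: N => [|N ih].
  by apply: nearW => n; exists set0; split=> //; rewrite measure0 expr0 subrr mulr0.
have [_ KN] := KP N.
apply: filterS2 ih KN => n [B [mB PB KB]] [C [mC PC KC]].
exists (B `|` C); split; first exact: measurableU.
  apply: le_trans (measureU2 _ mB mC) _; apply: le_trans (leeD PB PC) _.
  by rewrite -EFinD lee_fin exprS; move: (2^-1 ^+ N) => z; lra.
move=> w /not_orP[nB nC] j; rewrite ltnS leq_eqVlt => /orP[/eqP->|]; first exact: KC.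
exact: KB.
Qed.

(** A general filter and varying probability spaces let it serve both for n tending to infinity and
    for alpha tending to 0+. *)
Let open_lb (J : Type) (F : set_system J) (FF : Filter F) (dJ : J -> measure_display)
    (OJ : forall j, measurableType (dJ j)) (PJ : forall j, probability (OJ j) R)
    (YJ : forall j, OJ j -> S) (g : S -> R) (G : set S) (l e : R) :
  (\forall j \near F, measurable_fun setT (@YJ j : OJ j -> borel S)) ->
  open G -> unif01 g -> (forall x, ~ G x -> g x = 0) -> 0 < e ->
  \int[PJ j]_w g (@YJ j w) @[j --> F] --> l ->
  \forall j \near F, l - e <= fine (PJ j (@YJ j @^-1` G)).
Proof.
move=> mYJ oG ug g0 e0 /cvgrPdist_le/(_ _ e0) h; have [g01 _] := ug.
near=> j; have mj : measurable_fun setT (@YJ j : OJ j -> borel S) by near: j.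
have hj : `|l - \int[PJ j]_w g (@YJ j w)| <= e by near: j.
have : \int[PJ j]_w g (@YJ j w) <= fine (PJ j (@YJ j @^-1` G)).
  apply: le_Rintegral_indic => //; first exact: measurable_unif01.
    exact: measurable_preimage.
  by move=> w Gw; exact: g0.
by move: hj; rewrite ler_norml => /andP[_]; lra.
Unshelve. all: by end_near. Qed.

Lemma deletion_limit : exists mu : probability (borel S) R,
  weak_cvg \oo (fun n => law (P n) (fun w => restrict_path T (@X n w))) mu /\
  weak_cvg 0^'+ (fun alpha : R => law (Q alpha) (@Xlim alpha)) mu.
Proof.
have [mu muP] := limit_measure mY a_cvg tight.
have near_mXlim : \forall alpha \near 0^'+,
    measurable_fun setT (@Xlim alpha : Om' alpha -> borel S).
  near=> alpha; apply: mXlim.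
  by apply/andP; split; near: alpha; [exact: nbhs_right_gt|exact: nbhs_right_lt].
exists mu; split; apply: weak_cvg_of_open.
- by apply: nearW => n; exact: mY.
- move=> G oG e e0; have e20 : 0 < e / 2 by rewrite divr_gt0.
  have [g [ug g0] mug] := muP G oG _ e20.
  have mYn : \forall n \near \oo, measurable_fun setT (@Y n : Om n -> borel S).
    by apply: nearW => n; exact: mY.
  have h := open_lb eventually_filter mYn oG ug g0 e20 (a_cvg ug).
  by apply: filterS h => n; move: mug; rewrite /a /Y; lra.
- exact: near_mXlim.
move=> G oG e e0; have e20 : 0 < e / 2 by rewrite divr_gt0.
have [g [ug g0] mug] := muP G oG _ e20.
have h := open_lb (at_right_proper_filter 0) near_mXlim oG ug g0 e20 (c_cvg ug).
by apply: filterS h => alpha; move: mug; rewrite /a /Y; lra.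
Unshelve. all: by end_near. Qed.

End deletion_limit.

Theorem theorem1
  (R : realType) (E : completeMetricType R)
  (E_locally_compact : locally_compact [set: E])
  (E_separable : separable E)
  (T : R) (T_gt0 : 0 < T)
  (d : nat -> measure_display) (Om : forall n, measurableType (d n))
  (P : forall n, probability (Om n) R)
  (X : forall n, Om n -> cadlag E `[0, +oo[)
  (X_process : forall n, is_process (X n))
  (X_modulus : forall eps : R, 0 < eps ->
    exists2 delta : R, 0 < delta & exists n0 : nat, forall n, (n0 <= n)%N ->
      (P n [set w | (eps%:E <= modulus (T + 1)%R (X n w) delta)%E]
        <= eps%:E)%E)
  (tau sigma : forall n, R -> nat -> {RV (P n) >-> R})
  (tau_sigma : forall n (alpha : R), 0 < alpha < 1 -> forall w,
    deletion_times (fun k => tau n alpha k w) (fun k => sigma n alpha k w))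
  (d' : R -> measure_display) (Om' : forall alpha : R, measurableType (d' alpha))
  (Q : forall alpha : R, probability (Om' alpha) R)
  (Xlim : forall alpha : R, Om' alpha -> skorokhod E T)
  (Xlim_process : forall alpha : R, 0 < alpha < 1 -> is_process (Xlim alpha))
  (deleted_small : forall alpha : R, 0 < alpha < 1 ->
    exists n0 : nat, forall n, (n0 <= n)%N ->
      (P n [set w | (alpha <= T + 1 -
          kept_length (fun k => tau n alpha k w) (fun k => sigma n alpha k w)
            (T + 1))%R] <= alpha%:E)%E)
  (deleted_cvg : forall (alpha : R) (alpha01 : 0 < alpha < 1),
    weak_cvg \oo
      (fun n => law (P n)
        (fun w => delete_path T (X n w) (tau_sigma n alpha alpha01 w)))
      (law (Q alpha) (Xlim alpha))) :
  exists mu : probability (borel (skorokhod E T)) R,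
    weak_cvg \oo (fun n => law (P n) (fun w => restrict_path T (X n w))) mu /\
    weak_cvg 0^'+ (fun alpha : R => law (Q alpha) (Xlim alpha)) mu.
Proof.
exact: (@deletion_limit R E E_separable T T_gt0 d Om P X X_process X_modulus tau
  sigma tau_sigma d' Om' Q Xlim Xlim_process deleted_small deleted_cvg).
Qed.
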